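(* Let $C$ be an orientation of a cycle of even length at least $6$. If $\alpha_C(2)=0$ and both $\alpha_C(4)+\alpha_C(2,2)$ and $\gamma_C$ are non-zero and have different signs, then $C$ is not quasirandom-forcing.
   Context: A kernel is a bounded measurable function $[0,1]^2\to\mathbb{R}$. A tournamenton is a non-negative kernel $W$ with $W(x,y)+W(y,x)=1$ for all $(x,y)$. For an oriented graph $H$ and a kernel $U$, $t(H,U)=\int_{[0,1]^{V(H)}}\prod_{vw\in E(H)}U(x_v,x_w)\,\mathrm{d}x_{V(H)}$; $\|H\|$ is the number of edges of $H$. $H$ is quasirandom-forcing if every tournamenton $W$ with $t(H,W)=2^{-\|H\|}$ equals $1/2$ almost everywhere. For a positive integer $n$, $Q_{2n}$ is the orientation of the path with $2n$ edges in which all edges are oriented away from the central vertex towards the two end vertices. For an oriented cycle $C$ and $F\subseteq E(C)$, $C\langle F\rangle$ is the spanning subgraph with edge set $F$. For positive integers $n_1,\ldots,n_k$, $\alpha_C(2n_1,\ldots,2n_k)$ is the number of sets $F\subseteq E(C)$ such that $C\langle F\rangle$ can be obtained from the vertex-disjoint union $Q_{2n_1}\cup\cdots\cup Q_{2n_k}$ by reversing an even number of edges and possibly adding isolated vertices, minus the number of sets $F$ such that $C\langle F\rangle$ can be obtained from it by reversing an odd number of edges and possibly adding isolated vertices. For $n\ge 2$, $D_{2n}$ is the orientation of the cycle with $2n$ vertices obtained by choosing two opposite vertices and orienting all edges in the direction from one of them to the other. For an oriented cycle $C$ of even length $\ell$, $\gamma_C=+1$ if $C$ can be obtained from $D_\ell$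 by reversing an even number of edges, and $\gamma_C=-1$ otherwise. *)

(* Defs.v *)
From HB Require Import structures.
From mathcomp Require Import all_boot all_order all_algebra.
From mathcomp Require Import all_classical all_reals all_analysis.

Set Implicit Arguments.
Unset Strict Implicit.
Unset Printing Implicit Defensive.

Import Order.TTheory GRing.Theory Num.Theory.

Local Open Scope classical_set_scope.
Local Open Scope ring_scope.

Section power_measure.
Context d (T : measurableType d) (R : realType).

Definition tuple_cons n (x : T * n.-tuple T) : n.+1.-tuple T :=
  [the n.+1.-tuple T of x.1 :: x.2].

Lemma measurable_tuple_cons n : measurable_fun [set: T * n.-tuple T] (@tuple_cons n).
Proof. exact: measurable_cons. Qed.

Definition tuple_uncons n (t : n.+1.-tuple T) : T * n.-tuple T :=
  (tnth t ord0, [tuple of behead t]).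

Lemma measurable_tuple_uncons n :
  measurable_fun [set: n.+1.-tuple T] (@tuple_uncons n).
Proof.
by apply/measurable_fun_pairP; split;
  [exact: measurable_tnth | exact: measurable_behead].
Qed.

Lemma tuple_consK n : cancel (@tuple_cons n) (@tuple_uncons n).
Proof.
by move=> [a t]; rewrite /tuple_uncons /tuple_cons /=; congr pair; exact: val_inj.
Qed.

Section cons_measure.
Variables (n : nat) (m1 : {sigma_finite_measure set T -> \bar R}).
Variable m2 : {sigma_finite_measure set (n.-tuple T) -> \bar R}.

Definition cons_measure : set (n.+1.-tuple T) -> \bar R :=
  pushforward (m1 \x m2)%E (@tuple_cons n).

Let cons_measure0 : cons_measure set0 = 0%E.
Proof. by rewrite /cons_measure /pushforward preimage_set0 measure0. Qed.

Let cons_measure_ge0 A : (0 <= cons_measure A)%E.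
Proof. exact: (measure_ge0 (m1 \x m2)%E). Qed.

Let cons_measure_sigma_additive : semi_sigma_additive cons_measure.
Proof.
apply: (@measure_semi_sigma_additive _ _ _ (pushforward _ _)).
exact: measurable_tuple_cons.
Qed.

HB.instance Definition _ := isMeasure.Build _ _ _ cons_measure
  cons_measure0 cons_measure_ge0 cons_measure_sigma_additive.

Let cons_measure_sigma_finite : sigma_finite setT cons_measure.
Proof.
have /sigma_finiteP[F [TF ndF Foo]] := sigma_finiteT m1.
have /sigma_finiteP[G [TG ndG Goo]] := sigma_finiteT m2.
exists (fun k => @tuple_uncons n @^-1` (F k `*` G k)).
  apply/esym; rewrite -subTset => t _ /=.
  have [i _ Fi] : (\bigcup_i F i) (tuple_uncons t).1 by rewrite -TF.
  have [j _ Gj] : (\bigcup_i G i) (tuple_uncons t).2 by rewrite -TG.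
  exists (maxn i j) => //; split.
    by move: Fi; exact/subsetPset/ndF/leq_maxl.
  by move: Gj; exact/subsetPset/ndG/leq_maxr.
move=> k; have [mF Fk] := Foo k; have [mG Gk] := Goo k.
split.
  rewrite -[X in measurable X]setTI.
  by apply: measurable_tuple_uncons => //; exact: measurableX.
rewrite /cons_measure /pushforward -comp_preimage.
rewrite (_ : _ \o _ = id); last by apply/funext => x /=; exact: tuple_consK.
by rewrite preimage_id product_measure1E// lte_mul_pinfty// ge0_fin_numE.
Qed.

HB.instance Definition _ :=
  Measure_isSigmaFinite.Build _ _ _ cons_measure cons_measure_sigma_finite.
End cons_measure.

(* The n-fold product of mu with itself, on n-tuples. *)
Fixpoint power_measure (mu : {sigma_finite_measure set T -> \bar R}) (n : nat) :
    {sigma_finite_measure set (n.-tuple T) -> \bar R} :=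
  match n with
  | 0 => \d_([tuple] : 0.-tuple T)
  | n'.+1 => cons_measure mu (power_measure mu n')
  end.
End power_measure.

(* The pair (v, w) is the edge oriented from v to w. *)
Record digraph := Digraph { vertex :> finType; edge : {set vertex * vertex} }.

(* With v = w this also excludes loops. *)
Definition oriented (G : digraph) : Prop :=
  forall v w : G, (v, w) \in edge G -> (w, v) \notin edge G.

Definition digraph_iso (G H : digraph) : Prop :=
  exists2 f : G -> H, bijective f &
    forall v w, ((f v, f w) \in edge H) = ((v, w) \in edge G).

Definition reverse_edges (G : digraph) (S : {set G * G}) : digraph :=
  Digraph ((edge G :\: S) :|: [set (e.2, e.1) | e in S])%SET.

Definition disjoint_union (G H : digraph) : digraph :=
  @Digraph (G + H)%type
    ([set (inl e.1, inl e.2) | e in edge G]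
     :|: [set (inr e.1, inr e.2) | e in edge H])%SET.

Definition edgeless (m : nat) : digraph := @Digraph 'I_m finset.set0.

Definition spanning_subgraph (G : digraph) (F : {set G * G}) : digraph :=
  Digraph F.

(* p is the parity of the number of reversed edges: [false] stands for even. *)
Definition reversal (p : bool) (G H : digraph) : Prop :=
  exists S : {set G * G},
    [/\ S \subset edge G, odd #|S| = p & digraph_iso (reverse_edges S) H].

Definition reversal_isolated (p : bool) (G H : digraph) : Prop :=
  exists S : {set G * G},
    [/\ S \subset edge G, odd #|S| = p &
      exists m, digraph_iso (disjoint_union (reverse_edges S) (edgeless m)) H].

(* Q_l for even l: the path 0, 1, ..., l with central vertex l./2. *)
Definition out_path (l : nat) : digraph :=
  @Digraph 'I_l.+1 [set e : 'I_l.+1 * 'I_l.+1 |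
    ((l./2 <= e.1)%N && (e.2 == e.1.+1 :> nat))
    || ((e.1 <= l./2)%N && (e.1 == e.2.+1 :> nat))]%SET.

Definition out_paths (s : seq nat) : digraph :=
  foldr (fun l G => disjoint_union (out_path l) G) (edgeless 0) s.

(* D_l for even l: the cycle 0, 1, ..., l - 1, 0 whose two halves between the
   vertices 0 and l./2 are both oriented from 0 to l./2. *)
Definition two_path_cycle (l : nat) : digraph :=
  @Digraph 'I_l [set e : 'I_l * 'I_l |
    ((e.1 < l./2)%N && (e.2 == e.1.+1 :> nat))
    || ((l./2 <= e.2)%N && (e.1 == (e.2.+1 %% l)%N :> nat))]%SET.

Definition oriented_cycle (C : digraph) : Prop :=
  [/\ (2 < #|C|)%N, oriented C &
    exists2 f : 'I_#|C| -> C, bijective f &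
      forall i j, ((f i, f j) \in edge C) || ((f j, f i) \in edge C)
                  = (j == (i.+1 %% #|C|)%N :> nat) || (i == (j.+1 %% #|C|)%N :> nat)].

(* [alpha C [:: 2 * n1; ...; 2 * nk]] is alpha_C(2 n1, ..., 2 nk). *)
Definition alpha (C : digraph) (s : seq nat) : int :=
  let count p := #|[set F : {set C * C} | (F \subset edge C)
    && `[< reversal_isolated p (out_paths s) (spanning_subgraph F) >] ]%SET| in
  (count false)%:Z - (count true)%:Z.

Definition gamma (C : digraph) : int :=
  if `[< reversal false (two_path_cycle #|C|) C >] then 1 else -1.

Section tournamentons.
Variable R : realType.
Implicit Types U W : R -> R -> R.

Local Notation I := (`[0%R, 1%R]%classic : set R).
Local Notation mu := (@lebesgue_measure R).

(* Functions on the unit square are represented by functions on R * R, whose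
   values outside of the square are irrelevant. *)
Definition is_kernel U : Prop :=
  measurable_fun (I `*` I) (fun z : R * R => U z.1 z.2)
  /\ exists M : R, forall x y, I x -> I y -> `|U x y| <= M.

Definition tournamenton W : Prop :=
  [/\ is_kernel W,
      forall x y, I x -> I y -> 0 <= W x y &
      forall x y, I x -> I y -> W x y + W y x = 1].

(* The coordinate of x indexed by the vertex v is the one of rank v. *)
Definition density (H : digraph) U : R :=
  (\int[power_measure mu #|H|]_(x in [set x | forall i, I (tnth x i)])
    \prod_(e in edge H) U (tnth x (enum_rank e.1)) (tnth x (enum_rank e.2)))%R.

Definition quasirandom_forcing (H : digraph) : Prop :=
  forall W, tournamenton W -> density H W = 2 ^- #|edge H| ->
    {ae (mu \x mu)%E, forall z : R * R, (I `*` I) z -> W z.1 z.2 = 2^-1}.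

End tournamentons.

(* Main.v *)
Require Import Defs.
From mathcomp Require Import all_boot all_order all_algebra.
From mathcomp Require Import all_classical all_reals all_analysis.
From mathcomp Require Import perm measurable_realfun zify ring lra.

(* On four blocks of measure 1/4 let [a] and [b] be two orthogonal mean-zero
   sign vectors and consider W = 1/2 + U with U(x,y) = a(x)c(y) - c(x)a(y),
   c = u + v b. Expanding the product over E(C), t(C,W) is the sum over
   F of 2^-(l-|F|) t(C<F>,U).
   - If v = 0, then t(C<F>,U) vanishes for |F| odd (flip the sign of a) and when
     some component of C<F> is a single edge; the terms with |F| = 2 add up to a
     multiple of alpha_C(2) = 0, and since t(Q_4,U) = t(Q_2,U)^2 = u^4 the terms
     with |F| = 4 add up to a positive multiple of alpha_C(4) + alpha_C(2,2).
     Hence for small u this determines the sign of t(C,W) - 2^-l.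
   - If u = 0, then U has zero degrees, so that only F = E(C) contributes, and
     t(C,W) - 2^-l = t(C,U) has the sign of gamma_C because t(D_l,U) > 0.
   Along a segment joining two such points (u,v), the polynomial t(C,W) - 2^-l
   changes sign, while U is never 0. *)

Set Implicit Arguments.
Unset Strict Implicit.
Unset Printing Implicit Defensive.

Import Order.TTheory GRing.Theory Num.Theory.

Local Open Scope ring_scope.

(** * Homomorphism densities into a finite weighted target *)

Section HomDensity.
Variables (R : numFieldType) (X : finType).
Implicit Types (G H : digraph) (M : X -> X -> R).

Definition hom_sum G M : R :=
  \sum_(phi : {ffun G -> X}) \prod_(e in edge G) M (phi e.1) (phi e.2).

(** This is t(G, U) for the step kernel U with values [M] on blocks of equal measure; [density_step]
    proves it for non-negative [M]. *)
Definition hom_density G M : R := hom_sum G M / #|X|%:R ^+ #|G|.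

Lemma big_edge_imset (T1 T2 : finType) (h : T1 -> T2) (E : {set T1 * T1})
    (F : T2 * T2 -> R) : injective h ->
  \prod_(e in [set (h e.1, h e.2) | e in E]%SET) F e
  = \prod_(e in E) F (h e.1, h e.2).
Proof.
by move=> h_inj; rewrite big_imset// => -[a b] [c d] _ _ /= [/h_inj-> /h_inj->].
Qed.

Lemma hom_density_iso G H M :
  digraph_iso G H -> hom_density G M = hom_density H M.
Proof.
case=> f [g fK gK] f_edge.
rewrite /hom_density (bij_eq_card (Bijective fK gK)); congr (_ / _).
rewrite /hom_sum (reindex (fun psi : {ffun H -> X} => [ffun v => psi (f v)])) /=.
  apply: eq_bigr => psi _.
  have -> : edge H = [set (f e.1, f e.2) | e in edge G]%SET.
    apply/setP => -[x y]; rewrite -(gK x) -(gK y) f_edge.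
    apply/idP/imsetP => [xy|[[a b] ab [/(can_inj fK)-> /(can_inj fK)->]]//].
    by exists (g x, g y).
  rewrite (big_edge_imset _ (fun e => M (psi e.1) (psi e.2)) (can_inj fK)).
  by apply: eq_bigr => e _; rewrite !ffunE.
exists (fun phi : {ffun G -> X} => [ffun x => phi (g x)]) => phi _;
  by apply/ffunP => x; rewrite !ffunE ?fK ?gK.
Qed.

Lemma hom_sum_union G H M :
  hom_sum (disjoint_union G H) M = hom_sum G M * hom_sum H M.
Proof.
rewrite /hom_sum mulr_suml.
under [RHS]eq_bigr do rewrite mulr_sumr.
rewrite pair_big /=.
rewrite (reindex (fun p : {ffun G -> X} * {ffun H -> X} =>
  [ffun z : G + H => match z with inl v => p.1 v | inr w => p.2 w end])) /=.
  apply: eq_bigr => -[phi psi] _ /=.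
  rewrite (big_setID [set (inl e.1, inl e.2) | e in edge G]%SET) /=.
  rewrite finset.setUK finset.setDUl finset.setDv finset.set0U.
  rewrite (_ : (_ :\: _)%SET = [set (inr e.1, inr e.2) | e in edge H]%SET); last first.
    apply/finset.setDidPl; rewrite -setI_eq0; apply/eqP/setP => e; rewrite !inE.
    by apply/negP => /andP[/imsetP[a _ ->] /imsetP[b _]].
  rewrite (big_edge_imset _ _ (@inl_inj G H)) (big_edge_imset _ _ (@inr_inj G H)).
  by congr (_ * _); apply: eq_bigr => e _; rewrite !ffunE.
exists (fun phi : {ffun G + H -> X} =>
  ([ffun v => phi (inl v)], [ffun w => phi (inr w)])) => [[phi psi] _|phi _] /=.
  by congr pair; apply/ffunP => v; rewrite !ffunE.
by apply/ffunP => -[v|w]; rewrite !ffunE.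
Qed.

Lemma hom_density_union G H M :
  hom_density (disjoint_union G H) M = hom_density G M * hom_density H M.
Proof.
by rewrite /hom_density hom_sum_union card_sum exprD invfM mulrACA.
Qed.

Lemma hom_density_no_edge G M :
  (0 < #|X|)%N -> edge G = finset.set0 -> hom_density G M = 1.
Proof.
move=> X_gt0 G0; rewrite /hom_density /hom_sum.
under eq_bigr do rewrite G0 big_set0.
rewrite sumr_const card_ffun natrX divff//.
by rewrite expf_neq0// pnatr_eq0 -lt0n.
Qed.

Lemma hom_density_edgeless m M : (0 < #|X|)%N -> hom_density (edgeless m) M = 1.
Proof. by move=> X_gt0; exact: hom_density_no_edge. Qed.

(** Orientedness keeps the reversed pairs apart from the remaining edges, so no factor is lost and
    each reversal costs exactly one sign. *)
Lemma reverse_edges_card_prod G (S : {set G * G}) (F : G * G -> R) :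
  oriented G -> S \subset edge G ->
  (forall v w, F (w, v) = - F (v, w)) ->
  \prod_(e in edge (reverse_edges S)) F e = (-1) ^+ #|S| * \prod_(e in edge G) F e.
Proof.
move=> oG sS FN.
have swap_inj : injective (fun e : G * G => (e.2, e.1)).
  by move=> [a b] [c d] [-> ->].
rewrite [in RHS](big_setID S) /= (finset.setIidPr sS) mulrA -prodrN.
rewrite (big_setID [set (e.2, e.1) | e in S]%SET) /=.
rewrite finset.setUC finset.setUK finset.setDUl finset.setDv finset.set0U.
rewrite (_ : (_ :\: _ :\: _)%SET = (edge G :\: S)%SET); last first.
  apply/finset.setDidPl; rewrite -setI_eq0; apply/eqP/setP => e; rewrite !inE.
  apply/negP => /andP[/andP[_ eG] /imsetP[[a b] /(fintype.subsetP sS) ab eE]].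
  by move: eG; rewrite eE; apply/negP/oG.
rewrite big_imset /=; last by move=> e e' _ _; exact: swap_inj.
by congr (_ * _); apply: eq_bigr => -[a b] _; exact: FN.
Qed.

Lemma hom_density_reverse G (S : {set G * G}) M :
  oriented G -> S \subset edge G -> (forall x y, M y x = - M x y) ->
  hom_density (reverse_edges S) M = (-1) ^+ #|S| * hom_density G M.
Proof.
move=> oG sS MN; rewrite /hom_density mulrA; congr (_ / _).
rewrite /hom_sum mulr_sumr; apply: eq_bigr => phi _.
exact: (reverse_edges_card_prod (G := G) (F := fun e => M (phi e.1) (phi e.2))) oG sS _.
Qed.

Lemma hom_density_reversal p G H M :
  oriented G -> (forall x y, M y x = - M x y) -> reversal p G H ->
  hom_density H M = (-1) ^+ p * hom_density G M.
Proof.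
move=> oG MN [S [sS <- /(hom_density_iso M) <-]].
by rewrite hom_density_reverse// signr_odd.
Qed.

Lemma hom_density_reversal_isolated p G H M : (0 < #|X|)%N ->
  oriented G -> (forall x y, M y x = - M x y) -> reversal_isolated p G H ->
  hom_density H M = (-1) ^+ p * hom_density G M.
Proof.
move=> X_gt0 oG MN [S [sS <- [m /(hom_density_iso M) <-]]].
by rewrite hom_density_union hom_density_edgeless// mulr1 hom_density_reverse// signr_odd.
Qed.

Lemma hom_density_scale G M c :
  hom_density G (fun x y => c * M x y) = c ^+ #|edge G| * hom_density G M.
Proof.
rewrite /hom_density mulrA; congr (_ / _); rewrite /hom_sum mulr_sumr.
by apply: eq_bigr => phi _; rewrite big_split /= prodr_const.
Qed.

Lemma hom_density_eq G M N : M =2 N -> hom_density G M = hom_density G N.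
Proof.
move=> MN; rewrite /hom_density; congr (_ / _).
by apply: eq_bigr => phi _; apply: eq_bigr => e _; rewrite MN.
Qed.

(** An injective self-map of a finite set is a bijection, so reindexing shows that the sum is its
    own negative. The sign-reversing symmetries of the kernel all enter through this lemma. *)
Lemma hom_density_antisym_eq0 G M (t : {ffun G -> X} -> {ffun G -> X}) :
  injective t ->
  (forall phi, \prod_(e in edge G) M (t phi e.1) (t phi e.2) =
             - \prod_(e in edge G) M (phi e.1) (phi e.2)) ->
  hom_density G M = 0.
Proof.
move=> t_inj tN; suff h0 : hom_sum G M = 0 by rewrite /hom_density h0 mul0r.
have : hom_sum G M = - hom_sum G M.
  rewrite {1}/hom_sum (reindex_inj t_inj) /= -sumrN.
  by apply: eq_bigr => phi _; exact: tN.
by move/eqP; rewrite eq_sym eqNr => /eqP.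
Qed.

Lemma prodrD_subset (T : finType) (E : {set T}) (c : R) (F : T -> R) :
  \prod_(e in E) (c + F e) =
  \sum_(A : {set T} | A \subset E) c ^+ (#|E| - #|A|) * \prod_(e in A) F e.
Proof.
rewrite big_mkcond /=.
(* Outside [E] the two summands are 0 and 1, so that after distributing only the subsets of [E]
   contribute. *)
transitivity (\prod_e ((if e \in E then F e else 0) + (if e \in E then c else 1))).
  by apply: eq_bigr => e _; case: ifP; rewrite ?add0r// addrC.
rewrite bigA_distr /= [RHS]big_mkcond; apply: eq_bigr => A _.
case: ifPn => [sA|/subsetPn[e eA eE]]; last first.
  by rewrite (bigD1 e)//= eA (negPf eE) mul0r.
rewrite mulrC (bigID (mem A)) /=; congr (_ * _).
  by apply: eq_bigr => e eA; rewrite eA (fintype.subsetP sA).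
rewrite -cardsDS// -prodr_const [RHS]big_mkcond [LHS]big_mkcond /=.
by apply: eq_bigr => e _; rewrite inE; case: (e \in A).
Qed.

Lemma hom_density_expand G M (c : R) :
  hom_density G (fun x y => c + M x y) =
  \sum_(F : {set G * G} | F \subset edge G)
     c ^+ (#|edge G| - #|F|) * hom_density (spanning_subgraph F) M.
Proof.
transitivity (\sum_(F : {set G * G} | F \subset edge G)
    (c ^+ (#|edge G| - #|F|) * hom_sum (spanning_subgraph F) M) / #|X|%:R ^+ #|G|).
  rewrite -mulr_suml /hom_density; congr (_ / _); rewrite /hom_sum.
  under eq_bigr do rewrite prodrD_subset.
  by rewrite exchange_big; apply: eq_bigr => F _; rewrite mulr_sumr.
by apply: eq_bigr => F _; rewrite -mulrA.
Qed.

End HomDensity.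

(** * Summation over functions on ordinals, one value at a time *)

Section FunctionsOnOrdinals.
Variables (R : nmodType) (X : finType).

Definition fcons n (x : X) (f : 'I_n -> X) (i : 'I_n.+1) : X :=
  oapp f x (unlift ord0 i).

Lemma fcons0 n x (f : 'I_n -> X) : fcons x f ord0 = x.
Proof. by rewrite /fcons unlift_none. Qed.

Lemma fconsS n x (f : 'I_n -> X) i : fcons x f (lift ord0 i) = f i.
Proof. by rewrite /fcons liftK. Qed.

Lemma sum_ffun_ord0 (F : ('I_0 -> X) -> R) f :
  \sum_(phi : {ffun 'I_0 -> X}) F phi = F f.
Proof.
rewrite (big_pred1 [ffun i => f i]) => [|phi]; last first.
  by apply/esym/eqP/ffunP => -[].
by congr F; apply/funext => -[].
Qed.

(** [F] takes plain functions, so that the lemma can be iterated and the values read off by [fcons0]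
    and [fconsS]. *)
Lemma sum_ffun_ordS n (F : ('I_n.+1 -> X) -> R) :
  \sum_(phi : {ffun 'I_n.+1 -> X}) F phi =
  \sum_x \sum_(phi : {ffun 'I_n -> X}) F (fcons x phi).
Proof.
rewrite pair_big /=.
rewrite (reindex (fun p : X * {ffun 'I_n -> X} => [ffun i => fcons p.1 p.2 i])) /=.
  by apply: eq_bigr => p _; congr F; apply/funext => i; rewrite ffunE.
exists (fun phi => (phi ord0, [ffun i => phi (lift ord0 i)])) => [[x phi] _|phi _] /=.
  rewrite ffunE fcons0; congr (_, _).
  by apply/ffunP => i; rewrite !ffunE fconsS.
apply/ffunP => i; rewrite ffunE.
by case: (unliftP ord0 i) => [j ->|->]; rewrite ?fcons0 ?fconsS ?ffunE.
Qed.

End FunctionsOnOrdinals.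

(** * Orientedness of the model graphs *)

Lemma oriented_disjoint_union G H :
  oriented G -> oriented H -> oriented (disjoint_union G H).
Proof.
move=> oG oH v w; rewrite /= !inE negb_or.
case/orP => /imsetP[[a b] /= ab [-> ->]]; apply/andP; split;
  apply/negP => /imsetP[[c d] cd] //= [? ?]; subst.
  by move: (oG _ _ ab); rewrite cd.
by move: (oH _ _ ab); rewrite cd.
Qed.

Lemma oriented_edgeless m : oriented (edgeless m).
Proof. by move=> v w; rewrite inE. Qed.

Lemma oriented_out_path l : oriented (out_path l).
Proof. by move=> v w; rewrite !inE /=; lia. Qed.

Lemma oriented_out_paths s : oriented (out_paths s).
Proof.
elim: s => [|l s IHs]; first exact: oriented_edgeless.
by apply: oriented_disjoint_union => //; exact: oriented_out_path.
Qed.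

(** Trades the modulus for a case distinction within reach of linear arithmetic. *)
Lemma modn_ltn2 l m : (m < l + l)%N -> (m %% l)%N = if (m < l)%N then m else (m - l)%N.
Proof.
move=> ml; case: ltnP => [|lm]; first exact: modn_small.
by rewrite -{1}(subnK lm) modnDr modn_small//; lia.
Qed.

Lemma oriented_two_path_cycle l : (2 < l)%N -> oriented (two_path_cycle l).
Proof.
move=> l2 v w; rewrite !inE /=; have := ltn_ord v; have := ltn_ord w => wl vl.
rewrite !modn_ltn2; [|lia|lia].
by do 2!case: ifP => ?; lia.
Qed.

(** * The four-block kernel and its densities of Q_2, Q_4 and D_l *)

Section FourBlocks.
Variable R : realFieldType.
Local Notation X := (bool * bool)%type.

Definition sign1 (x : X) : R := (-1) ^+ x.1.
Definition sign2 (x : X) : R := (-1) ^+ x.2.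

Definition wedge (u v : R) (x y : X) : R :=
  sign1 x * (u + v * sign2 y) - (u + v * sign2 x) * sign1 y.

Lemma wedgeN u v x y : wedge u v y x = - wedge u v x y.
Proof. by rewrite /wedge; ring. Qed.

Lemma wedge_scale c u v x y : wedge (c * u) (c * v) x y = c * wedge u v x y.
Proof. by rewrite /wedge; ring. Qed.

Lemma sum_blocks (F : X -> R) : \sum_x F x =
  F (true, true) + F (true, false) + (F (false, true) + F (false, false)).
Proof.
transitivity (\sum_b \sum_c F (b, c)); last by rewrite big_bool !big_bool.
by rewrite pair_bigA; apply: eq_bigr => -[].
Qed.

Lemma card_blocks : #|{: X}| = 4.
Proof. by rewrite card_prod card_bool. Qed.

Ltac blocks := rewrite sum_blocks /wedge /sign1 /sign2 /= ?expr0 ?expr1.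

(** As 1, a = [sign1] and b = [sign2] are orthogonal with square sums 4, the kernel, as an operator,
    sends 1 and c = u + v b to multiples of a, and a to a multiple of c. Paths can thus be summed
    off vertex by vertex. *)
Lemma sum_wedge u v x : \sum_y wedge u v x y = 4 * u * sign1 x.
Proof. by blocks; ring. Qed.

Lemma sum_wedge_sign1 u v x :
  \sum_y wedge u v x y * sign1 y = - 4 * (u + v * sign2 x).
Proof. by blocks; ring. Qed.

Lemma sum_wedge_sign2 u v x :
  \sum_y wedge u v x y * (u + v * sign2 y) = 4 * (u ^+ 2 + v ^+ 2) * sign1 x.
Proof. by blocks; ring. Qed.

(** Membership in the edge set becomes a numerical condition, which evaluates once [big_ord_recl]
    has listed all pairs. *)
Lemma prod_out_path l (K : 'I_l.+1 -> 'I_l.+1 -> R) :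
  \prod_(e in edge (out_path l)) K e.1 e.2 =
  \prod_(i < l.+1) \prod_(j < l.+1) (if ((l./2 <= i)%N && (j == i.+1 :> nat))
    || ((i <= l./2)%N && (i == j.+1 :> nat)) then K i j else 1).
Proof.
rewrite big_mkcond /= [RHS]pair_bigA; apply: eq_bigr => -[i j] _.
by rewrite inE.
Qed.

Lemma hom_density_out_path2 u v : hom_density (out_path 2) (wedge u v) = u ^+ 2.
Proof.
rewrite /hom_density card_blocks card_ord.
(* There are 4 ^ 3 = 64 maps; likewise 4 ^ 5 = 1024 for the longer path. *)
suff -> : hom_sum (out_path 2) (wedge u v) = 64 * u ^+ 2 by field.
transitivity (\sum_x \sum_y \sum_z wedge u v y x * wedge u v y z).
  rewrite /hom_sum.
  pose F (f : 'I_3 -> X) := \prod_(e in edge (out_path 2)) wedge u v (f e.1) (f e.2).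
  transitivity (\sum_(phi : {ffun 'I_3 -> X}) F phi) => //.
  rewrite (sum_ffun_ordS (fun f => F f)); apply: eq_bigr => x0 _.
  rewrite (sum_ffun_ordS (fun f => F (fcons x0 f))); apply: eq_bigr => x1 _.
  rewrite (sum_ffun_ordS (fun f => F (fcons x0 (fcons x1 f)))); apply: eq_bigr => x2 _.
  rewrite (sum_ffun_ord0 (fun f => F (fcons x0 (fcons x1 (fcons x2 f)))) (fun=> x0)) /F.
  rewrite (prod_out_path (fun i j => wedge u v (_ i) (_ j))).
  rewrite !big_ord_recl !big_ord0 /=.
  by rewrite !mul1r !mulr1 !fconsS !fcons0.
(* First the end z is summed off, then the centre y, then the end x; antisymmetry turns the edge
   between x and y so that [sum_wedge_sign1] applies. *)
under eq_bigr do under eq_bigr do rewrite -mulr_sumr sum_wedge.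
under eq_bigr do under eq_bigr do rewrite wedgeN mulNr mulrCA -mulrN.
under eq_bigr do rewrite -mulr_sumr sumrN sum_wedge_sign1.
by blocks; ring.
Qed.

Lemma hom_density_out_path4 u v :
  hom_density (out_path 4) (wedge u v) = u ^+ 2 * (u ^+ 2 + v ^+ 2).
Proof.
rewrite /hom_density card_blocks card_ord.
suff -> : hom_sum (out_path 4) (wedge u v) = 1024 * (u ^+ 2 * (u ^+ 2 + v ^+ 2)).
  by field.
transitivity (\sum_x0 \sum_x1 \sum_x2 \sum_x3 \sum_x4
    wedge u v x1 x0 * wedge u v x2 x1 * wedge u v x2 x3 * wedge u v x3 x4).
  rewrite /hom_sum.
  pose F (f : 'I_5 -> X) := \prod_(e in edge (out_path 4)) wedge u v (f e.1) (f e.2).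
  transitivity (\sum_(phi : {ffun 'I_5 -> X}) F phi) => //.
  rewrite (sum_ffun_ordS (fun f => F f)); apply: eq_bigr => x0 _.
  rewrite (sum_ffun_ordS (fun f => F (fcons x0 f))); apply: eq_bigr => x1 _.
  rewrite (sum_ffun_ordS (fun f => F (fcons x0 (fcons x1 f)))); apply: eq_bigr => x2 _.
  rewrite (sum_ffun_ordS (fun f => F (fcons x0 (fcons x1 (fcons x2 f))))).
  apply: eq_bigr => x3 _.
  rewrite (sum_ffun_ordS (fun f => F (fcons x0 (fcons x1 (fcons x2 (fcons x3 f)))))).
  apply: eq_bigr => x4 _.
  rewrite (sum_ffun_ord0
    (fun f => F (fcons x0 (fcons x1 (fcons x2 (fcons x3 (fcons x4 f)))))) (fun=> x0)) /F.
  rewrite (prod_out_path (fun i j => wedge u v (_ i) (_ j))).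
  rewrite !big_ord_recl !big_ord0 /=.
  by rewrite !mul1r !mulr1 !fconsS !fcons0 !mulrA.
(* The half x2, x3, x4 is summed off first. Turning the edge between x1 and x2 leaves the factor in
   x2 in the form of [sum_wedge_sign2]. *)
have sum34 x0 x1 x2 :
    \sum_x3 \sum_x4 wedge u v x1 x0 * wedge u v x2 x1 * wedge u v x2 x3 * wedge u v x3 x4
    = 16 * u * wedge u v x1 x0 * (wedge u v x1 x2 * (u + v * sign2 x2)).
  transitivity (wedge u v x1 x0 * wedge u v x2 x1 * (4 * u)
      * \sum_x3 wedge u v x2 x3 * sign1 x3).
    rewrite mulr_sumr; apply: eq_bigr => x3 _.
    by rewrite -mulr_sumr sum_wedge; ring.
  by rewrite sum_wedge_sign1 (wedgeN u v x1 x2); ring.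
under eq_bigr do under eq_bigr do under eq_bigr do rewrite sum34.
under eq_bigr do under eq_bigr do rewrite -mulr_sumr sum_wedge_sign2.
rewrite exchange_big /=.
under eq_bigr do rewrite -mulr_suml -mulr_sumr sum_wedge.
by blocks; ring.
Qed.

(* Reversing every second edge of the directed cycle takes l / 2 reversals, as
   does D_l, so both orientations have the same density. In the former the edge
   kernels, at alternating positions p, split into the products below; by
   orthogonality only the constant choices of s round the cycle survive. *)
Definition cycle_factor (p s : bool) (x : X) : R :=
  if p then if s then sign2 x else sign1 x
  else if s then sign1 x else - sign2 x.

Lemma cycle_factor_wedge (p : bool) x y :
  (-1) ^+ p * wedge 0 1 x y =
  \sum_s cycle_factor p s x * cycle_factor (~~ p) s y.
Proof. by rewrite big_bool /wedge; case: p => /=; rewrite ?expr0 ?expr1; ring. Qed.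

Lemma cycle_factor_orthogonal p s t :
  \sum_x cycle_factor p s x * cycle_factor p t x = if s == t then 4 else 0.
Proof.
by rewrite sum_blocks /cycle_factor /sign1 /sign2; case: p; case: s; case: t;
  rewrite /= ?expr0 ?expr1; ring.
Qed.

Definition cycle_edge l (i : 'I_l) : 'I_l * 'I_l :=
  if (i < l./2)%N then (i, ordS i) else (ordS i, i).

Lemma val_ordS l (i : 'I_l) :
  ordS i = (if i.+1 < l then i.+1 else 0)%N :> nat.
Proof.
by have := ltn_ord i => il; rewrite /= modn_ltn2; [case: ifP; lia|lia].
Qed.

(** For l = 2 both positions would give the edge (0, 1), hence the bound. *)
Lemma cycle_edge_inj l : (2 < l)%N -> injective (@cycle_edge l).
Proof.
move=> l2 i j; rewrite /cycle_edge => ij; apply: val_inj => /=.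
have := val_ordS i; have := val_ordS j; have := ltn_ord i; have := ltn_ord j.
have e1 := congr1 (fun e : 'I_l * 'I_l => e.1 : nat) ij.
have e2 := congr1 (fun e : 'I_l * 'I_l => e.2 : nat) ij.
move: e1 e2; do 2!case: ltnP => ? /=;
  move: (i.+1 %% l)%N (j.+1 %% l)%N => i' j' e1 e2 jl il; do 2!case: ltnP => ?; lia.
Qed.

Lemma edge_two_path_cycle l : (2 < l)%N -> ~~ odd l ->
  edge (two_path_cycle l) = [set cycle_edge i | i in 'I_l]%SET.
Proof.
move=> l2 l_even; apply/setP => -[i j]; rewrite !inE /=.
have hl : l = (l./2 + l./2)%N by lia.
apply/idP/imsetP => [|[k _]].
  case/orP => /andP[ih /eqP ij].
    exists i => //; rewrite /cycle_edge ih; congr pair; apply: val_inj => /=.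
    by rewrite modn_small//; have := ltn_ord j; lia.
  exists j => //; rewrite /cycle_edge ltnNge ih; congr pair.
  exact: val_inj.
rewrite /cycle_edge; case: ltnP => kh [-> ->]; rewrite ?kh /=; last by rewrite eqxx orbT.
by have := val_ordS k; rewrite /= => ->; rewrite ifT ?eqxx//; have := ltn_ord k; lia.
Qed.

(** The second half and the odd positions both have l / 2 elements, so both products are (-1) ^ (l /
    2). *)
Lemma prod_half_sign l : ~~ odd l ->
  \prod_(i < l) (-1) ^+ (l./2 <= i)%N = \prod_(i < l) (-1) ^+ odd i :> R.
Proof.
move=> l_even; have -> : l = (l./2).*2 by lia.
move: (l./2) => h; rewrite doubleK.
transitivity ((-1) ^+ h : R).
  rewrite -(big_mkord xpredT (fun i => (-1) ^+ (h <= i)%N)).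
  rewrite (big_cat_nat (n := h)) //=; last by lia.
  rewrite big1_seq ?mul1r => [|i /andP[_]]; last first.
    by rewrite mem_index_iota => /andP[_ ih]; rewrite leqNgt ih.
  rewrite (@eq_big_nat _ _ _ _ _ _ (fun=> -1)) => [|i /andP[hi _]]; last first.
    by rewrite hi.
  by rewrite big_const_nat -addnn addnK iter_mulr_1.
elim: h => [|h IHh]; first by rewrite big_ord0.
by rewrite doubleS !big_ord_recr /= -IHh odd_double exprS; ring.
Qed.

Lemma hom_sum_two_path_cycle_gt0 l : (2 < l)%N -> ~~ odd l ->
  0 < hom_sum (two_path_cycle l) (wedge 0 1).
Proof.
move=> l2 l_even.
have prod_edges (phi : {ffun 'I_l -> X}) :
    \prod_(e in edge (two_path_cycle l)) wedge 0 1 (phi e.1) (phi e.2) =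
    \prod_(i < l) \sum_(s : bool)
      cycle_factor (odd i) s (phi i) * cycle_factor (~~ odd i) s (phi (ordS i)).
  rewrite edge_two_path_cycle// big_imset /=; last by move=> i j _ _; exact: cycle_edge_inj.
  (* The alternating signs are exchanged for signs on the second half, where [cycle_edge] runs
     backwards and antisymmetry absorbs them. *)
  under [RHS]eq_bigr do rewrite -cycle_factor_wedge.
  rewrite big_split /= -prod_half_sign// -big_split /=.
  apply: eq_big => [i|i _]; first by rewrite inE.
  by rewrite /cycle_edge; case: ltnP => _ /=; rewrite ?mul1r// wedgeN mulN1r.
(* Evenness of l makes the alternation close up between the last and the first position. *)
have odd_ordS (i : 'I_l) : odd (ordS i) = ~~ odd i.
  by have := ltn_ord i; rewrite val_ordS; case: ifP; lia.
(* Here [sigma] records the summand chosen at each edge. Vertex i meets only the edges at positions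
   i and i - 1, and summing over its block gives 4 or 0 by orthogonality. *)
have -> : hom_sum (two_path_cycle l) (wedge 0 1) =
    \sum_(sigma : {ffun 'I_l -> bool}) \prod_i
      (if sigma i == sigma (ord_pred i) then 4 else 0).
  rewrite /hom_sum; under eq_bigr do rewrite prod_edges bigA_distr_bigA.
  rewrite exchange_big; apply: eq_bigr => sigma _ /=.
  under [RHS]eq_bigr => i _ do rewrite -(cycle_factor_orthogonal (odd (i : nat))).
  rewrite bigA_distr_bigA; apply: eq_bigr => phi _.
  rewrite !big_split /=; congr (_ * _).
  rewrite [RHS](reindex_inj (@ordS_inj l)) /=.
  by apply: eq_bigr => i _; rewrite ordSK -odd_ordS.
(* All terms are non-negative, so one constant choice with its positive term suffices. *)
rewrite (bigD1 [ffun=> true]) //= ltr_wpDr//.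
  apply: sumr_ge0 => sigma _; apply: prodr_ge0 => i _.
  by case: ifP.
by apply: prodr_gt0 => i _; rewrite !ffunE eqxx.
Qed.

End FourBlocks.

(** * Vanishing densities from sign-reversing symmetries *)

Section Vanishing.
Variable R : realFieldType.
Local Notation X := (bool * bool)%type.
Implicit Types (G : digraph).

(** Flipping the first bit negates [sign1] and hence the kernel; doing so at every vertex gives one
    sign per edge. *)
Lemma hom_density_odd_eq0 G (u v : R) :
  odd #|edge G| -> hom_density G (wedge u v) = 0.
Proof.
move=> oddG; pose flip (x : X) : X := (~~ x.1, x.2).
have flipK : involutive flip by move=> [x y]; rewrite /flip /= negbK.
apply: (hom_density_antisym_eq0 (t := fun phi : {ffun G -> X} => [ffun z => flip (phi z)])).
  move=> phi psi /ffunP eq_t; apply/ffunP => z; have := eq_t z.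
  by rewrite !ffunE => /(inv_inj flipK).
move=> phi; transitivity ((-1) ^+ #|edge G| *
    \prod_(e in edge G) wedge u v (phi e.1) (phi e.2)).
  rewrite -prodrN; apply: eq_bigr => e _; rewrite !ffunE /flip.
  by rewrite /wedge /sign1 /sign2 /= !signrN; ring.
by rewrite -signr_odd oddG expr1 mulN1r.
Qed.

(** Exchanging the images of the two ends of [e] negates its factor and touches no other. *)
Lemma hom_density_isolated_edge_eq0 G (M : X -> X -> R) (e : G * G) :
  (forall x y, M y x = - M x y) ->
  e \in edge G ->
  (forall e', e' \in edge G -> e' != e ->
    [/\ e'.1 != e.1, e'.1 != e.2, e'.2 != e.1 & e'.2 != e.2]) ->
  hom_density G M = 0.
Proof.
move=> MN eG isol; pose s := tperm e.1 e.2.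
apply: (hom_density_antisym_eq0 (t := fun phi : {ffun G -> X} => [ffun z => phi (s z)])).
  move=> phi psi /ffunP eq_t; apply/ffunP => z; have := eq_t (s z).
  by rewrite !ffunE /s tpermK.
move=> phi; rewrite (bigD1 e)//= [in RHS](bigD1 e)//= -mulNr; congr (_ * _).
  by rewrite !ffunE /s tpermL tpermR MN.
apply: eq_bigr => e' /andP[e'G e'e]; have [? ? ? ?] := isol e' e'G e'e.
by rewrite !ffunE /s !tpermD// eq_sym.
Qed.

(** For u = 0 the kernel is linear in (a(x), b(x)), so flipping both bits at the leaf [z] negates
    the only factor that involves it. *)
Lemma hom_density_leaf_eq0 G (v : R) (z : G) (e : G * G) :
  e \in edge G -> (e.1 == z) (+) (e.2 == z) ->
  (forall e', e' \in edge G -> e' != e -> e'.1 != z /\ e'.2 != z) ->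
  hom_density G (wedge 0 v) = 0.
Proof.
move=> eG ez leaf; pose flip (x : X) : X := (~~ x.1, ~~ x.2).
have flipK : involutive flip by move=> [x y]; rewrite /flip /= !negbK.
pose t (phi : {ffun G -> X}) := [ffun y => if y == z then flip (phi y) else phi y].
apply: (hom_density_antisym_eq0 (t := t)).
  move=> phi psi /ffunP eq_t; apply/ffunP => y; have := eq_t y; rewrite !ffunE.
  by case: eqP => // _ /(inv_inj flipK).
have flipN x y : wedge 0 v (flip x) y = - wedge 0 v x y.
  by rewrite /wedge /sign1 /sign2 /flip /= !signrN; ring.
move=> phi; rewrite (bigD1 e)//= [in RHS](bigD1 e)//= -mulNr; congr (_ * _).
  rewrite !ffunE; move: ez; case: eqP; case: eqP => //= _ _ _.
  by rewrite wedgeN flipN opprK wedgeN.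
apply: eq_bigr => e' /andP[e'G e'e]; have [/negPf n1 /negPf n2] := leaf e' e'G e'e.
by rewrite !ffunE n1 n2.
Qed.

End Vanishing.

(** * Embeddings up to orientation yield reversals *)

Section Reversals.
Variables (G H : digraph) (F : {set H * H}) (h : G -> H).
Hypothesis oF : oriented (spanning_subgraph F).
Hypothesis h_inj : injective h.
Hypothesis h_edge : forall v w, (v, w) \in edge G -> ((h v, h w) \in F) || ((h w, h v) \in F).
Hypothesis F_edge : forall x y, (x, y) \in F ->
  exists v w, (v, w) \in edge G /\ ((x, y) = (h v, h w) \/ (x, y) = (h w, h v)).

Definition reversed_edges : {set G * G} :=
  [set e in edge G | (h e.1, h e.2) \notin F]%SET.

Lemma reversed_edges_sub : reversed_edges \subset edge G.
Proof. by apply/fintype.subsetP => e; rewrite inE => /andP[]. Qed.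

Lemma edge_reversed v w :
  ((h v, h w) \in F) = ((v, w) \in edge (reverse_edges reversed_edges)).
Proof.
rewrite !inE /=; apply/idP/orP => [hF|[/andP[]|/imsetP[[a b]]]].
- have [a [b [ab [[/h_inj va /h_inj wb]|[/h_inj va /h_inj wb]]]]] := F_edge hF; subst.
    by left; rewrite hF ab andbF.
  (* As [F] is oriented, the opposite pair is not in [F], so this edge is among the reversed
     ones. *)
  right; apply/imsetP; exists (a, b) => //; rewrite inE ab /=.
  exact: oF hF.
- by move=> + vw; rewrite vw negbK.
- rewrite inE => /andP[/= ab hab] [-> ->].
  by have := h_edge ab; rewrite (negPf hab).
Qed.

Lemma F_image x y : (x, y) \in F -> (x \in codom h) && (y \in codom h).
Proof. by move=> /F_edge[v [w [_ [[-> ->]|[-> ->]]]]]; rewrite !codom_f. Qed.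

Lemma embedding_reversal_isolated :
  exists p, reversal_isolated p G (spanning_subgraph F).
Proof.
exists (odd #|reversed_edges|), reversed_edges; split=> //; first exact: reversed_edges_sub.
(* The vertices missed by [h] are the isolated vertices to be added. *)
pose A := [set x | x \notin codom h]%SET.
exists #|A|.
pose f (z : G + 'I_#|A|) : H := match z with inl v => h v | inr i => enum_val i end.
have enumA (i : 'I_#|A|) : enum_val i \notin codom h by have := enum_valP i; rewrite inE.
exists f.
  apply: inj_card_bij.
    move=> [v|i] [w|j] /=.
    - by move=> /h_inj ->.
    - by move=> hv; have := enumA j; rewrite -hv codom_f.
    - by move=> hv; have := enumA i; rewrite hv codom_f.
    - by move=> /enum_val_inj ->.
  rewrite card_sum card_ord -(card_codom h_inj) -[leqLHS](cardC (mem (codom h))).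
  rewrite leq_add2l; apply/eq_leq/eq_card => x; rewrite !inE.
  done.
move=> [v|i] [w|j]; rewrite /= !inE.
- rewrite edge_reversed !inE /=; apply/idP/orP => [vw|[]/imsetP[[a b] ab] //].
    by left; apply/imsetP; exists (v, w); rewrite ?inE.
  by move=> [-> ->]; move: ab; rewrite !inE.
- apply/idP/orP => [/F_image/andP[_]|[]/imsetP[[a b] ab] //].
  by rewrite (negPf (enumA j)).
- apply/idP/orP => [/F_image/andP[]|[]/imsetP[[a b] ab] //].
  by rewrite (negPf (enumA i)).
- apply/idP/orP => [/F_image/andP[]|[]/imsetP[[a b]]]; last 2 first.
  + by [].
  + by rewrite inE.
  by rewrite (negPf (enumA i)).
Qed.

Lemma embedding_reversal :
  bijective h -> exists p, reversal p G (spanning_subgraph F).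
Proof.
move=> h_bij; exists (odd #|reversed_edges|), reversed_edges.
split=> //; first exact: reversed_edges_sub.
by exists h => // v w; exact: edge_reversed.
Qed.

End Reversals.

(** * Cyclic labellings of an oriented cycle *)

Section CyclicLabelling.
Variable C : digraph.
Local Notation l := #|C|.

(* Indices are taken modulo the length of the cycle, so that labellings can be
   shifted freely. *)
Definition cyclic_labelling (g : nat -> C) : Prop :=
  [/\ forall i j, (g i == g j) = (i == j %[mod l]),
      forall x, exists i, g i = x &
      forall i j, ((g i, g j) \in edge C) || ((g j, g i) \in edge C)
                  = (j == i.+1 %[mod l]) || (i == j.+1 %[mod l])].

Definition label_edge (g : nat -> C) (i : nat) : C * C :=
  if (g i, g i.+1) \in edge C then (g i, g i.+1) else (g i.+1, g i).

Lemma label_edgeP g i :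
  (label_edge g i = (g i, g i.+1)) \/ (label_edge g i = (g i.+1, g i)).
Proof. by rewrite /label_edge; case: ifP; [left|right]. Qed.

Lemma path_edge_label g s m a b : ~~ odd m ->
  (a, b) \in edge (out_path m) ->
  exists k, [/\ (k < m)%N & label_edge g (s + k) = (g (s + a)%N, g (s + b)%N)
                         \/ label_edge g (s + k) = (g (s + b)%N, g (s + a)%N)].
Proof.
move=> m_even; rewrite inE /= => /orP[] /andP[mh /eqP ab].
  exists a; split; first by have := ltn_ord b; lia.
  by rewrite ab addnS; exact: label_edgeP.
exists b; split; first by have := ltn_ord a; lia.
by rewrite ab addnS or_comm; exact: label_edgeP.
Qed.

Lemma label_path_edge g s m k : ~~ odd m -> (k < m)%N ->
  exists a b : 'I_m.+1, (a, b) \in edge (out_path m) /\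
    (label_edge g (s + k) = (g (s + a)%N, g (s + b)%N) \/
     label_edge g (s + k) = (g (s + b)%N, g (s + a)%N)).
Proof.
move=> m_even km; have k1 : (k < m.+1)%N by lia.
pose a := Ordinal k1; pose b := Ordinal (km : k.+1 < m.+1)%N.
have [kh|kh] := leqP m./2 k.
  exists a, b; split; first by rewrite inE /= kh eqxx.
  by rewrite /= addnS; exact: label_edgeP.
exists b, a; split; first by rewrite inE /= kh eqxx orbT.
by rewrite /= addnS or_comm; exact: label_edgeP.
Qed.

Lemma oriented_cycle_labelling : oriented_cycle C -> exists g, cyclic_labelling g.
Proof.
case=> l2 _ [f f_bij f_edge]; have l0 : (0 < l)%N by lia.
exists (fun i => f (Ordinal (ltn_pmod i l0))); split.
- by move=> i j; rewrite (bij_eq f_bij).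
- case: f_bij => f' _ f'K x; exists (f' x).
  by rewrite -[RHS]f'K; congr f; apply: val_inj; rewrite /= modn_small.
- by move=> i j; rewrite f_edge /= -!(addn1 (_ %% _)) !modnDml !addn1.
Qed.

Hypotheses (l2 : (2 < l)%N) (oC : oriented C).

Lemma labelling_shift g k :
  cyclic_labelling g -> cyclic_labelling (fun i => g (i + k)%N).
Proof.
case=> g_eq g_surj g_edge; split.
- by move=> i j; rewrite g_eq eqn_modDr.
(* Adding k (l - 1) undoes the shift by k modulo l. *)
- move=> x; have [i <-] := g_surj x; exists (i + k * l.-1)%N; apply/eqP; rewrite g_eq.
  have -> : (i + k * l.-1 + k = k * l + i)%N by nia.
  by rewrite modnMDl.
- by move=> i j; rewrite g_edge -!addSn !eqn_modDr.
Qed.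

Section Labelled.
Variable g : nat -> C.
Hypothesis gP : cyclic_labelling g.
Local Notation e := (label_edge g).

Lemma label_eq i j : (g i == g j) = (i == j %[mod l]).
Proof. by case: gP. Qed.

Lemma label_inj i j : (i < l)%N -> (j < l)%N -> g i = g j -> i = j.
Proof.
by move=> il jl /eqP; rewrite label_eq !modn_small// => /eqP.
Qed.

Lemma label_edge_mod i j : i = j %[mod l] -> e i = e j.
Proof.
move=> ij; have gij : g i = g j by apply/eqP; rewrite label_eq ij.
have gSij : g i.+1 = g j.+1.
  by apply/eqP; rewrite label_eq -addn1 -(addn1 j) eqn_modDr ij.
by rewrite /label_edge gij gSij.
Qed.

Lemma label_edge_in i : e i \in edge C.
Proof.
rewrite /label_edge; case: ifPn => // /negPf gN.
by case: gP => _ _ /(_ i i.+1); rewrite gN /= => ->; rewrite eqxx.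
Qed.

Lemma edge_label i j : (g i, g j) \in edge C ->
  (j = i.+1 %[mod l] /\ (g i, g j) = e i) \/ (i = j.+1 %[mod l] /\ (g i, g j) = e j).
Proof.
move=> gij; have := gij.
case: gP => _ _ /(_ i j); rewrite gij /= => /esym/orP[] /eqP ij _.
  left; split=> //; have gj : g j = g i.+1 by apply/eqP; rewrite label_eq ij.
  by rewrite /label_edge -gj gij.
right; split=> //; have gi : g i = g j.+1 by apply/eqP; rewrite label_eq ij.
by rewrite /label_edge -gi (negPf (oC gij)).
Qed.

Lemma label_edge_surj x : x \in edge C -> exists2 i, (i < l)%N & x = e i.
Proof.
case: x => x y; case: gP => _ g_surj _.
have [i <-] := g_surj x; have [j <-] := g_surj y => /edge_label.
case=> -[_ ->]; [exists (i %% l)%N|exists (j %% l)%N]; rewrite ?ltn_mod//; try lia;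
  by apply: label_edge_mod; rewrite modn_mod.
Qed.

(** Only the positions i and i - 1 meet the vertex [g i]; the last alternative is the wrap-around
    for i = 0. *)
Lemma label_edge_touch i j : (i < l)%N -> (j < l)%N ->
  ((e j).1 == g i) || ((e j).2 == g i) -> [\/ j = i, j.+1 = i | i = 0%N /\ j.+1 = l].
Proof.
move=> il jl; have : ((e j).1 == g i) || ((e j).2 == g i) -> (g j == g i) || (g j.+1 == g i).
  by case: (label_edgeP g j) => -> //=; rewrite orbC.
move=> /[apply]; rewrite !label_eq !modn_ltn2; [|lia..].
rewrite il jl; case: ifP => jl' /orP[]/eqP; [|by constructor 2|by constructor 1|].
  by constructor 1.
by move=> ?; constructor 3; lia.
Qed.

Lemma label_edge_inj i j : (i < l)%N -> (j < l)%N -> e i = e j -> i = j.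
Proof.
move=> il jl eij.
have ti : ((e j).1 == g i) || ((e j).2 == g i).
  by rewrite -eij; case: (label_edgeP g i) => ->; rewrite /= eqxx ?orbT.
have tj : ((e i).1 == g j) || ((e i).2 == g j).
  by rewrite eij; case: (label_edgeP g j) => ->; rewrite /= eqxx ?orbT.
by case: (label_edge_touch il jl ti); case: (label_edge_touch jl il tj); lia.
Qed.

End Labelled.

(** If every edge of [F] were preceded by an edge of [F], going backwards from one of them would
    reach all positions. A step back is written as adding l - 1 to avoid subtraction. *)
Lemma boundary_labelling g (F : {set C * C}) : cyclic_labelling g ->
  F \subset edge C -> F != finset.set0 -> F != edge C ->
  exists g', [/\ cyclic_labelling g', label_edge g' 0 \in F & label_edge g' l.-1 \notin F].
Proof.
move=> gP FC /set0Pn[x xF] FnC.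
have [i0 i0l xE] := label_edge_surj gP (fintype.subsetP FC _ xF).
suff [i [iF iN]] : exists i, label_edge g i \in F /\ label_edge g (i + l.-1) \notin F.
  exists (fun k => g (k + i)%N); split; first exact: labelling_shift.
    exact: iF.
  by rewrite -[label_edge _ _]/(label_edge g (l.-1 + i)) addnC.
apply: contrapT => noi; move/negP: FnC; apply; rewrite finset.eqEsubset FC /=.
have step k : label_edge g (i0 + k * l.-1) \in F.
  elim: k => [|k IHk]; first by rewrite mul0n addn0 -xE.
  apply: contrapT => /negP kN; apply: noi; exists (i0 + k * l.-1)%N; split=> //.
  by rewrite -addnA (addnC (k * _)%N) -mulSn.
apply/fintype.subsetP => y /(label_edge_surj gP)[j _ ->].
(* The number of steps back is congruent to i0 - j, so the walk from i0 ends at position j. *)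
rewrite (label_edge_mod gP (j := (i0 + (i0 + l.-1 * j) * l.-1)%N))//.
have -> : (i0 + (i0 + l.-1 * j) * l.-1 = (i0 + (l - 2) * j) * l + j)%N by nia.
by rewrite modnMDl.
Qed.

End CyclicLabelling.

(* Here and in the next lemma m is the indicator of the positions of the edges
   in F; [~~ m i -> m i.+1 -> m i.+2] says that no edge of F is isolated. *)
Lemma three_consecutive_positions n j (m : pred nat) : (j < n)%N ->
  (forall i, ~~ m i -> m i.+1 -> m i.+2) ->
  (forall i, (i < n)%N -> m i -> [\/ i = 0, i = 1, i = 2 | i = j]%N) ->
  m j -> [/\ j <> 0, j <> 1, j <> 2 & j <> n.-1]%N -> j = 3.
Proof.
move=> jn notisol mE mj [j0 j1 j2 jl]; apply: contrapT => j3.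
(* If j > 3, then j - 1 is not a position of [F], so j + 1 must be one; but it is below n and not in
   the list. *)
have : ~~ m j.-1 by apply/negP => /(mE _ _)[]; lia.
by move=> /notisol; rewrite prednK => [/(_ mj)/(mE _ _)[]|]; lia.
Qed.

Lemma two_consecutive_pairs n j k (m : pred nat) :
  (forall i, ~~ m i -> m i.+1 -> m i.+2) ->
  (forall i, (i < n)%N -> m i -> [\/ i = 0, i = 1, i = j | i = k]%N) ->
  m j -> (2 < j < n.-1)%N -> (2 < k < n.-1)%N -> j <> k -> k = j.+1 \/ j = k.+1.
Proof.
move=> notisol mE mj jn kn jk; apply: contrapT => jkN.
have : ~~ m j.-1 by apply/negP => /(mE _ _)[]; lia.
by move=> /notisol; rewrite prednK => [/(_ mj)/(mE _ _)[]|]; lia.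
Qed.

(** * Subgraphs of a long cycle with non-zero density *)

Section SubgraphsOfCycles.
Variables (R : realFieldType) (C : digraph).
Local Notation l := #|C|.
Hypotheses (l6 : (6 <= l)%N) (cC : oriented_cycle C).
Let l2 : (2 < l)%N. Proof. lia. Qed.
Let oC : oriented C. Proof. by case: cC. Qed.

Lemma card_edge_cycle : #|edge C| = l.
Proof.
have [g gP] := oriented_cycle_labelling cC.
have -> : edge C = [set label_edge g i | i : 'I_l]%SET.
  apply/setP => x; apply/idP/imsetP => [/(label_edge_surj l2 oC gP)[i il ->]|[i _ ->]].
    by exists (Ordinal il).
  exact: label_edge_in.
rewrite card_imset ?card_ord// => i j /(label_edge_inj l2 gP (ltn_ord i) (ltn_ord j)).
exact: val_inj.
Qed.

Variable F : {set C * C}.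
Hypothesis FC : F \subset edge C.

Lemma oriented_spanning_subgraph : oriented (spanning_subgraph F).
Proof.
move=> v w vw; apply: contra (oC (fintype.subsetP FC _ vw)).
exact: (fintype.subsetP FC).
Qed.

Section Labelled.
Variable g : nat -> C.
Hypothesis gP : cyclic_labelling g.
Local Notation e := (label_edge g).

Lemma hom_density_isolated_label_eq0 (M : bool * bool -> bool * bool -> R) :
  (forall x y, M y x = - M x y) ->
  e 0 \in F -> e 1 \notin F -> e l.-1 \notin F ->
  hom_density (spanning_subgraph F) M = 0.
Proof.
move=> MN e0 e1 el.
apply: (hom_density_isolated_edge_eq0 (G := spanning_subgraph F) (e := e 0)) => // x xF x0.
have [j jl xE] := label_edge_surj l2 oC gP (fintype.subsetP FC _ xF).
suff touchN i : (i < 2)%N -> (x.1 != g i) && (x.2 != g i).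
  have /andP[? ?] := touchN 0%N isT; have /andP[? ?] := touchN 1%N isT.
  by case: (label_edgeP g 0) => ->; split.
move=> i2; rewrite -negb_or; apply/negP; rewrite xE => /label_edge_touch.
have jN0 : j <> 0%N by move=> j0; rewrite xE j0 eqxx in x0.
have jN1 : j <> 1%N by move=> j1; rewrite xE j1 (negPf e1) in xF.
have jNl : j <> l.-1 by move=> j1; rewrite xE j1 (negPf el) in xF.
by case=> //; lia.
Qed.

Lemma path_reversal_isolated m : ~~ odd m -> (m < l)%N ->
  (forall k, (k < m)%N -> e k \in F) ->
  (forall x, x \in F -> exists2 k, (k < m)%N & x = e k) ->
  exists p, reversal_isolated p (out_paths [:: m]) (spanning_subgraph F).
Proof.
move=> m_even ml eF Fe.
(* The value on [inr] is a dummy, as [edgeless 0] has no vertices. *)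
pose h (z : out_paths [:: m]) : C := match z with inl a => g a | inr _ => g 0%N end.
apply: (embedding_reversal_isolated (G := out_paths [:: m]) (F := F) (h := h)).
- exact: oriented_spanning_subgraph.
- move=> [a|[]//] [b|[]//] /= /(label_inj gP) ab; congr inl; apply: val_inj.
  by apply: ab; have := ltn_ord a; have := ltn_ord b; lia.
- move=> v w; rewrite /= inE => /orP[] /imsetP[[a b] ab [-> ->]]; last by rewrite inE in ab.
  have [k [km]] := path_edge_label g 0 m_even ab.
  by rewrite /= !add0n => -[] <-; rewrite eF// orbT.
- move=> x y /Fe[k km ->]; have [a [b [ab]]] := label_path_edge g 0 m_even km.
  rewrite !add0n => abE; exists (inl a), (inl b); split=> //=.
  by rewrite inE; apply/orP; left; apply/imsetP; exists (a, b).
Qed.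

(** The bounds on j keep the paths on the vertices 0, 1, 2 and j, j + 1, j + 2 disjoint, also around
    the end of the cycle. *)
Lemma two_paths_reversal_isolated j : (2 < j)%N -> (j.+2 < l)%N ->
  e 0 \in F -> e 1 \in F -> e j \in F -> e j.+1 \in F ->
  (forall x, x \in F -> [\/ x = e 0, x = e 1, x = e j | x = e j.+1]) ->
  exists p, reversal_isolated p (out_paths [:: 2; 2]%N) (spanning_subgraph F).
Proof.
move=> j2 jl e0 e1 ej ej1 Fe.
pose h (z : out_paths [:: 2; 2]%N) : C :=
  match z with inl a => g a | inr (inl a) => g (j + a)%N | inr (inr _) => g 0%N end.
have eF k : (k < 2)%N -> (e (0 + k) \in F) && (e (j + k) \in F).
  by case: k => [|[|//]] _; rewrite ?addn0 ?addn1 ?e0 ?e1 ?ej.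
have m2 : ~~ odd 2 by [].
have edge_path k s : (k < 2)%N -> (s == 0)%N || (s == j) ->
  exists v w, (v, w) \in edge (out_paths [:: 2; 2]%N) /\
    (e (s + k) = (h v, h w) \/ e (s + k) = (h w, h v)).
  move=> k2 /orP[]/eqP ->.
    have [a [b [ab abE]]] := label_path_edge g 0 m2 k2.
    exists (inl a), (inl b); split; last exact: abE.
    by rewrite inE; apply/orP; left; apply/imsetP; exists (a, b).
  have [a [b [ab abE]]] := label_path_edge g j m2 k2.
  exists (inr (inl a)), (inr (inl b)); split; last exact: abE.
  rewrite inE; apply/orP; right; apply/imsetP; exists (inl a, inl b) => //.
  by rewrite inE; apply/orP; left; apply/imsetP; exists (a, b).
apply: (embedding_reversal_isolated (G := out_paths [:: 2; 2]%N) (F := F) (h := h)).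
- exact: oriented_spanning_subgraph.
- have lt3 (i : 'I_3) : (i < 3)%N := ltn_ord i.
  by move=> [a|[a|[]//]] [b|[b|[]//]] /= /(label_inj gP) ab; move: (lt3 a) (lt3 b) => *;
    [congr inl|exfalso|exfalso|congr (inr (inl _))]; try (apply: val_inj => /=); lia.
- move=> v w; rewrite /= inE => /orP[] /imsetP[[a b] + [-> ->]].
    move=> /(path_edge_label g 0 m2)[k [/eF/andP[kF _]]].
    by rewrite /= !add0n => -[] <-; rewrite kF// orbT.
  rewrite inE => /orP[]/imsetP[[c d] + [-> ->]]; last by rewrite inE.
  move=> /(path_edge_label g j m2)[k [/eF/andP[_ kF]]].
  by rewrite /= => -[] <-; rewrite kF// orbT.
- move=> x y /Fe[] ->.
  + exact: (edge_path 0 0)%N.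
  + exact: (edge_path 1 0)%N.
  + by have := edge_path 0%N j isT; rewrite eqxx orbT addn0; apply.
  + by have := edge_path 1%N j isT; rewrite eqxx orbT addn1; apply.
Qed.

End Labelled.

Lemma hom_density_isolated_label_shift_eq0 g i (M : bool * bool -> bool * bool -> R) :
  cyclic_labelling g -> (forall x y, M y x = - M x y) ->
  label_edge g i.+1 \in F -> label_edge g i.+2 \notin F -> label_edge g i \notin F ->
  hom_density (spanning_subgraph F) M = 0.
Proof.
move=> gP MN e0 e1 el.
apply: (hom_density_isolated_label_eq0 (labelling_shift l2 i.+1 gP)) => //.
rewrite -[label_edge _ _]/(label_edge g (l.-1 + i.+1)).
rewrite (label_edge_mod gP (j := i))//; have -> : (l.-1 + i.+1 = i + l)%N by lia.
by rewrite modnDr.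
Qed.

(** Rotates the labelling so that a run of consecutive edges of [F] begins at position 0. *)
Lemma proper_labelling : (0 < #|F| < l)%N ->
  exists g, [/\ cyclic_labelling g, label_edge g 0 \in F & label_edge g l.-1 \notin F].
Proof.
move=> /andP[F0 Fl]; have [g gP] := oriented_cycle_labelling cC.
apply: (boundary_labelling l2 oC gP) => //; first by rewrite -card_gt0.
by apply: contraTneq Fl => ->; rewrite card_edge_cycle ltnn.
Qed.

(** The vertex at which a run of edges begins is a leaf of the subgraph. *)
Lemma hom_density_proper_subgraph_eq0 (v : R) : (0 < #|F| < l)%N ->
  hom_density (spanning_subgraph F) (wedge 0 v) = 0.
Proof.
move=> /proper_labelling[g [gP e0 el]].
have g01 : g 0%N == g 1%N = false by rewrite (label_eq gP) !modn_small//; lia.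
apply: (hom_density_leaf_eq0 (G := spanning_subgraph F) (z := g 0%N) v e0).
  by case: (label_edgeP g 0) => ->; rewrite /= eqxx eq_sym g01.
move=> x xF x0; have [j jl xE] := label_edge_surj l2 oC gP (fintype.subsetP FC _ xF).
suff : ~~ ((x.1 == g 0%N) || (x.2 == g 0%N)) by rewrite negb_or => /andP.
apply/negP; rewrite xE => /label_edge_touch.
have jN0 : j <> 0%N by move=> j0; rewrite xE j0 eqxx in x0.
have jNl : j <> l.-1 by move=> j1; rewrite xE j1 (negPf el) in xF.
by case=> //; lia.
Qed.

Section Nonzero.
Variable M : bool * bool -> bool * bool -> R.
Hypothesis MN : forall x y, M y x = - M x y.
Hypothesis F_neq0 : hom_density (spanning_subgraph F) M != 0.

Lemma two_edges_reversal : #|F| = 2 ->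
  exists p, reversal_isolated p (out_paths [:: 2]%N) (spanning_subgraph F).
Proof.
move=> F2; have [|g [gP e0 el]] := proper_labelling; first by rewrite F2; lia.
have e1 : label_edge g 1 \in F.
  apply: contraNT F_neq0 => e1; apply/eqP.
  exact: (hom_density_isolated_label_eq0 gP).
have e01 : label_edge g 1 != label_edge g 0.
  by apply/eqP => /(label_edge_inj l2 gP); lia.
have FE : [set label_edge g 0; label_edge g 1]%SET = F.
  by apply/eqP; rewrite eqEcard F2 cards2 eq_sym e01 finset.subUset !finset.sub1set e0 e1.
apply: (path_reversal_isolated gP); [by []|lia| |].
  by case=> [|[]].
by move=> x; rewrite -FE !inE => /orP[]/eqP ->; [exists 0%N|exists 1%N].
Qed.

(** No run of consecutive edges can have length 1, so four edges form either one run of four or two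
    runs of two. *)
Lemma four_edges_reversal : #|F| = 4 ->
  exists p, reversal_isolated p (out_paths [:: 4]%N) (spanning_subgraph F) \/
            reversal_isolated p (out_paths [:: 2; 2]%N) (spanning_subgraph F).
Proof.
move=> F4; have [|g [gP e0 el]] := proper_labelling; first by rewrite F4; lia.
pose e := label_edge g.
have l0 : (0 < l)%N by lia.
have l1 : (1 < l)%N by lia.
have eI i j : (i < l)%N -> (j < l)%N -> (e i == e j) = (i == j).
  move=> il jl; apply/eqP/eqP => [|-> //]; exact: (label_edge_inj l2 gP).
have notisol i : e i \notin F -> e i.+1 \in F -> e i.+2 \in F.
  move=> ei eSi; apply: contraNT F_neq0 => eSSi; apply/eqP.
  exact: (hom_density_isolated_label_shift_eq0 gP MN eSi).
have e1 : e 1%N \in F.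
  apply: contraNT F_neq0 => e1; apply/eqP.
  exact: (hom_density_isolated_label_eq0 gP).
have [e2|e2] := boolP (e 2%N \in F).
  have : #|F :\ e 0%N :\ e 1%N :\ e 2%N| == 1.
    move: F4; rewrite (cardsD1 (e 0%N)) e0 (cardsD1 (e 1%N)) (cardsD1 (e 2%N)) !inE e1 e2.
    by rewrite !eI ?andbT //= ?add1n; case=> ->.
  move=> /cards1P[x FE]; have : x \in F :\ e 0%N :\ e 1%N :\ e 2%N by rewrite FE inE.
  rewrite !inE => /and4P[x2 x1 x0 xF].
  have [j jl] := label_edge_surj l2 oC gP (fintype.subsetP FC _ xF); rewrite -/e => xE.
  have FP y : y \in F -> [\/ y = e 0%N, y = e 1%N, y = e 2%N | y = x].
    move=> yF; have := congr1 (fun A : {set C * C} => y \in A) FE; rewrite !inE yF andbT.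
    case: eqP => [|_]; first by constructor 3.
    case: eqP => [|_]; first by constructor 2.
    case: eqP => [|_]; first by constructor 1.
    by move=> /esym/eqP; constructor 4.
  (* The run at 0 has at least three edges; the fourth edge cannot stand alone and must prolong
     it. *)
  have j3 : j = 3.
    apply: (@three_consecutive_positions l _ (fun i => e i \in F)) => //.
    - move=> i il /FP[/eqP|/eqP|/eqP|/eqP]; rewrite ?xE eI// => /eqP;
        by [constructor 1|constructor 2|constructor 3|constructor 4].
    - by rewrite -xE.
    - split=> jE; first by rewrite xE jE eqxx in x0.
      + by rewrite xE jE eqxx in x1.
      + by rewrite xE jE eqxx in x2.
      + by rewrite xE jE (negPf el) in xF.
  have [|||p pF] := path_reversal_isolated (m := 4) gP isT.
  - exact: leq_trans l6.
  - by case=> [|[|[|[|]]]]// _; rewrite xE j3 in xF.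
  - move=> y /FP[] ->; [exists 0%N|exists 1%N|exists 2%N|exists 3%N] => //.
    by rewrite xE j3.
  by exists p; left.
have : #|F :\ e 0%N :\ e 1%N| == 2.
  move: F4; rewrite (cardsD1 (e 0%N)) e0 (cardsD1 (e 1%N)) !inE e1.
  by rewrite !eI ?andbT //= ?add1n; case=> ->.
move=> /cards2P[x [y [xy FE]]].
have FP z : z \in F -> [\/ z = e 0%N, z = e 1%N, z = x | z = y].
  move=> zF; have := congr1 (fun A : {set C * C} => z \in A) FE; rewrite !inE zF andbT.
  case: eqP => [|_]; first by constructor 2.
  case: eqP => [|_]; first by constructor 1.
  by move=> /esym/orP[]/eqP; [constructor 3|constructor 4].
(* The run at 0 is exactly {0, 1}; the other two edges avoid the positions 2 and l - 1 next to
   it. *)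
have edgeF z : z \in [set x; y]%SET -> exists j,
    [/\ (j < l)%N, (2 < j < l.-1)%N, e j \in F & z = e j].
  rewrite -FE !inE => /and3P[z1 z0 zF].
  have [j jl] := label_edge_surj l2 oC gP (fintype.subsetP FC _ zF); rewrite -/e => zE.
  exists j; split=> //; last by rewrite -zE.
  have : j <> l.-1 by move=> jE; rewrite zE jE (negPf el) in zF.
  have : j <> 0%N by move=> jE; rewrite zE jE eqxx in z0.
  have : j <> 1%N by move=> jE; rewrite zE jE eqxx in z1.
  have : j <> 2%N by move=> jE; rewrite zE jE (negPf e2) in zF.
  by move: jl; clear; lia.
have [|j [jl jb ejF xE]] := edgeF x; first by rewrite !inE eqxx.
have [|k [kl kb ekF yE]] := edgeF y; first by rewrite !inE eqxx orbT.
have jk : j <> k by move=> jk; rewrite xE yE jk eqxx in xy.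
have {}jk : k = j.+1 \/ j = k.+1.
  apply: (@two_consecutive_pairs l _ _ (fun i => e i \in F)) => //.
  move=> i il /FP[/eqP|/eqP|/eqP|/eqP]; rewrite ?xE ?yE eI// => /eqP;
    by [constructor 1|constructor 2|constructor 3|constructor 4].
(* Names the smaller of the two adjacent positions i. *)
have [i [i2 il eiF eSiF FPi]] : exists i,
  [/\ (2 < i)%N, (i.+2 < l)%N, e i \in F, e i.+1 \in F &
    forall z, z \in F -> [\/ z = e 0%N, z = e 1%N, z = e i | z = e i.+1]].
  case: jk => jk; [exists j|exists k]; rewrite -?jk -xE -yE xE yE; split=> //.
  - by move: jb; clear; lia.
  - by move: kb; rewrite jk; clear; lia.
  - by move=> z; rewrite -xE -yE; apply: FP.
  - by move: kb; clear; lia.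
  - by move: jb; rewrite jk; clear; lia.
  - by move=> z /FP; rewrite xE yE => -[];
    [constructor 1|constructor 2|constructor 4|constructor 3].
have [p pF] := two_paths_reversal_isolated gP i2 il e0 e1 eiF eSiF FPi.
by exists p; right.
Qed.

End Nonzero.

End SubgraphsOfCycles.

(** Ensures that [gamma] = -1 comes from an odd reversal. *)
Lemma two_path_cycle_reversal C : oriented_cycle C ->
  exists p, reversal p (two_path_cycle #|C|) C.
Proof.
(* Destructing [C] makes it convertible to the spanning subgraph on its full edge set. *)
case: C => V E; set C := Digraph E => -[l2 oC [f f_bij f_edge]].
have f_inj := bij_inj f_bij.
have adj (i j : 'I_#|C|) : (i, j) \in edge (two_path_cycle #|C|) ->
    (j == (i.+1 %% #|C|)%N :> nat) || (i == (j.+1 %% #|C|)%N :> nat).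
  rewrite !inE /= => /orP[]/andP[ih /eqP ->]; last by rewrite eqxx orbT.
  by rewrite modn_small ?eqxx//; have := ltn_ord i; lia.
have adj' (i j : 'I_#|C|) : j = (i.+1 %% #|C|)%N :> nat ->
    ((i, j) \in edge (two_path_cycle #|C|)) || ((j, i) \in edge (two_path_cycle #|C|)).
  move=> jE; have [ih|ih] := ltnP i #|C|./2.
    have jS : j = i.+1 :> nat by rewrite jE modn_small//; move: ih l2; clear; lia.
    by rewrite !inE /= ih jS eqxx.
  by rewrite !inE /= ih jE eqxx !orbT.
apply: (embedding_reversal (G := two_path_cycle #|C|) (H := C) (h := f) (F := E)) => //.
  by move=> v w /adj; rewrite -f_edge.
case: (f_bij) => f' _ f'K x y; rewrite -[x]f'K -[y]f'K => xy.
have : ((f (f' x), f (f' y)) \in E) || ((f (f' y), f (f' x)) \in E) by rewrite xy.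
rewrite f_edge => /orP[/eqP/adj'|/eqP/adj']/orP[] eD.
- by exists (f' x), (f' y); split=> //; left.
- by exists (f' y), (f' x); split=> //; right.
- by exists (f' y), (f' x); split=> //; right.
- by exists (f' x), (f' y); split=> //; left.
Qed.

(** * The expansion of t(C, W) in terms of alpha and gamma *)

Section Coefficients.
Variables (R : realFieldType) (C : digraph).
Local Notation l := #|C|.
Hypotheses (l6 : (6 <= l)%N) (l_even : ~~ odd l) (cC : oriented_cycle C).
Local Notation hd F := (hom_density (spanning_subgraph F)).

Lemma hom_density_out_paths2 (u v : R) :
  hom_density (out_paths [:: 2]%N) (wedge u v) = u ^+ 2.
Proof.
rewrite /= hom_density_union hom_density_out_path2 hom_density_edgeless ?card_blocks//.
by rewrite mulr1.
Qed.

Lemma hom_density_out_paths4 (u v : R) :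
  hom_density (out_paths [:: 4]%N) (wedge u v) = u ^+ 2 * (u ^+ 2 + v ^+ 2).
Proof.
rewrite /= hom_density_union hom_density_out_path4 hom_density_edgeless ?card_blocks//.
by rewrite mulr1.
Qed.

Lemma hom_density_out_paths22 (u v : R) :
  hom_density (out_paths [:: 2; 2]%N) (wedge u v) = u ^+ 4.
Proof.
rewrite [out_paths _]/(disjoint_union (out_path 2) (out_paths [:: 2]%N)).
by rewrite hom_density_union hom_density_out_path2 hom_density_out_paths2; ring.
Qed.

Section ReversalsOfPaths.
Variables (F : {set C * C}) (p : bool).

Lemma density_reversal_isolated s (u v : R) :
  reversal_isolated p (out_paths s) (spanning_subgraph F) ->
  hd F (wedge u v) = (-1) ^+ p * hom_density (out_paths s) (wedge u v).
Proof.
apply: hom_density_reversal_isolated; first by rewrite card_blocks.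
  exact: oriented_out_paths.
exact: wedgeN.
Qed.

(** Doubling the kernel multiplies the density by 2 ^ |F|, so |F| is read off from two values of it;
    no edges of disjoint unions have to be counted. *)
Lemma card_reversal_isolated s n :
  hom_density (out_paths s) (wedge 2 0) = 2 ^+ n :> R ->
  hom_density (out_paths s) (wedge 1 0) = 1 :> R ->
  reversal_isolated p (out_paths s) (spanning_subgraph F) -> #|F| = n.
Proof.
move=> d2 d1 pF.
have := density_reversal_isolated 2 0 pF.
rewrite (@hom_density_eq _ _ _ _ (fun x y => 2 * wedge 1 0 x y)); last first.
  by move=> x y; rewrite -wedge_scale mulr1 mulr0.
rewrite hom_density_scale (density_reversal_isolated 1 0 pF) d1 d2 mulr1 mulrC.
move/(mulfI (negbT (signr_eq0 _ _)))/eqP; rewrite -!natrX eqr_nat eqn_exp2l//.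
by move/eqP.
Qed.

End ReversalsOfPaths.

Lemma alpha_sum s : alpha C s =
  \sum_(F : {set C * C} | F \subset edge C)
    (`[< reversal_isolated false (out_paths s) (spanning_subgraph F) >]%:Z
     - `[< reversal_isolated true (out_paths s) (spanning_subgraph F) >]%:Z).
Proof.
have count p : #|[set F : {set C * C} | (F \subset edge C)
    && `[< reversal_isolated p (out_paths s) (spanning_subgraph F) >] ]%SET|%:Z
    = \sum_(F : {set C * C} | F \subset edge C)
       `[< reversal_isolated p (out_paths s) (spanning_subgraph F) >]%:Z.
  rewrite -sum1_card (big_morph Posz PoszD (erefl _)) big_mkcond [RHS]big_mkcond /=.
  by apply: eq_bigr => F _; rewrite inE; case: (_ \subset _) => //=; case: asbool.
by rewrite /alpha !count sumrB.
Qed.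

Local Notation RI s p F := `[< reversal_isolated p (out_paths s) (spanning_subgraph F) >].

(** Termwise: a reversal of Q_2 of parity p has density (-1) ^ p, and every other two-edge subgraph
    has density 0. *)
Lemma sum_edges2 :
  \sum_(F : {set C * C} | (F \subset edge C) && (#|F| == 2)%N) hd F (wedge (1 : R) 0)
  = (alpha C [:: 2]%N)%:~R.
Proof.
rewrite alpha_sum rmorph_sum /= big_mkcondr; apply: eq_bigr => F FC.
have val p : RI [:: 2]%N p F -> hd F (wedge (1 : R) 0) = (-1) ^+ p.
  by move/asboolP/density_reversal_isolated => ->; rewrite hom_density_out_paths2; ring.
have card p : RI [:: 2]%N p F -> #|F| = 2.
  by move/asboolP; apply: card_reversal_isolated; rewrite hom_density_out_paths2; ring.
move: (val false) (val true) (card false) (card true).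
case Ef: (RI _ false F); case Et: (RI _ true F) => v0 v1 c0 c1; last 1 first.
  case: eqP => // F2; rewrite subrr; apply/eqP; apply: contraFT Ef => hN.
  have [[] /asboolP] := two_edges_reversal l6 cC FC (@wedgeN _ 1 0) hN F2.
    by rewrite Et.
  by [].
all: have -> : #|F| = 2 by [exact: c0|exact: c1].
all: rewrite eqxx.
(* Both parities at once would make the density 1 and -1. *)
- by have := v0 isT; rewrite v1//= expr0 expr1 => ?; lra.
- by rewrite v0.
- by rewrite v1//= sub0r rmorphN expr1.
Qed.

Lemma sum_edges4 :
  \sum_(F : {set C * C} | (F \subset edge C) && (#|F| == 4)%N) hd F (wedge (1 : R) 0)
  = (alpha C [:: 4]%N + alpha C [:: 2; 2]%N)%:~R.
Proof.
rewrite !alpha_sum -big_split /= rmorph_sum /= big_mkcondr; apply: eq_bigr => F FC.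
(* The value at (1, 1) is 2 up to sign for Q_4 and 1 for two copies of Q_2, so no [F] is counted by
   both alphas. *)
have val4 p : RI [:: 4]%N p F -> hd F (wedge (1 : R) 0) = (-1) ^+ p /\
    hd F (wedge (1 : R) 1) = (-1) ^+ p * 2.
  by move/asboolP => pF; split; rewrite (density_reversal_isolated _ _ pF)
    hom_density_out_paths4; ring.
have val22 p : RI [:: 2; 2]%N p F -> hd F (wedge (1 : R) 0) = (-1) ^+ p /\
    hd F (wedge (1 : R) 1) = (-1) ^+ p.
  by move/asboolP => pF; split; rewrite (density_reversal_isolated _ _ pF)
    hom_density_out_paths22; ring.
have card4 p : RI [:: 4]%N p F -> #|F| = 4.
  by move/asboolP; apply: card_reversal_isolated; rewrite hom_density_out_paths4; ring.
have card22 p : RI [:: 2; 2]%N p F -> #|F| = 4.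
  by move/asboolP; apply: card_reversal_isolated; rewrite hom_density_out_paths22; ring.
have ex : #|F| = 4 -> hd F (wedge (1 : R) 0) != 0 ->
    exists p, RI [:: 4]%N p F \/ RI [:: 2; 2]%N p F.
  move=> F4 hN; have [p [pF|pF]] := four_edges_reversal l6 cC FC (@wedgeN _ 1 0) hN F4.
    by exists p; left; apply/asboolP.
  by exists p; right; apply/asboolP.
move: (hd F (wedge 1 0)) (hd F (wedge 1 1)) val4 val22 card4 card22 ex => x y.
move=> val4 val22 card4 card22 ex.
move: (val4 false) (val4 true) (val22 false) (val22 true).
move: (card4 false) (card4 true) (card22 false) (card22 true) ex.
clear val4 val22 card4 card22.
have [F4|F4] := eqVneq #|F| 4; last first.
  case: (RI _ false F); case: (RI _ true F); case: (RI _ false F); case: (RI _ true F) => //=;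
  by move=> c0 c1 c2 c3; (have := c0 isT) + (have := c1 isT) + (have := c2 isT)
     + (have := c3 isT); move/eqP; rewrite (negPf F4).
move=> _ _ _ _ /(_ F4).
case a0: (RI _ false F); case a1: (RI _ true F); case b0: (RI _ false F);
  case b1: (RI _ true F); rewrite /= ?expr0 ?expr1 => ex v0 v1 v2 v3;
  try (have [? ?] := v0 isT); try (have [? ?] := v1 isT);
  try (have [? ?] := v2 isT); try (have [? ?] := v3 isT); try lra.
(* In the remaining case [F] is no reversal of either kind, so its density must be 0. *)
apply/eqP; apply: contraT => xN; have [[] [] pF] := ex xN.
- by have := etrans (esym pF) a1.
- by have := etrans (esym pF) b1.
- by have := etrans (esym pF) a0.
- by have := etrans (esym pF) b0.
Qed.

Lemma hom_density_cycle_wedge (v : R) : 0 < v ->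
  exists2 c : R, 0 < c & hom_density C (wedge 0 v) = (gamma C)%:~R * c.
Proof.
move=> v0; pose D := two_path_cycle l.
have l2 : (2 < l)%N by apply: leq_trans l6.
have D_gt0 : 0 < hom_density D (wedge 0 v).
  rewrite (@hom_density_eq _ _ _ _ (fun x y => v * wedge 0 1 x y)); last first.
    by move=> x y; rewrite -wedge_scale mulr1 mulr0.
  rewrite hom_density_scale mulr_gt0 ?exprn_gt0// divr_gt0//.
    exact: hom_sum_two_path_cycle_gt0.
  by rewrite exprn_gt0// card_blocks.
exists (hom_density D (wedge 0 v)) => //.
have D_or := oriented_two_path_cycle l2.
rewrite /gamma; case: asboolP => [evenC|oddC].
  by rewrite (hom_density_reversal D_or (@wedgeN _ 0 v) evenC) expr0.
have [[] pC] := two_path_cycle_reversal cC; last by [].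
by rewrite (hom_density_reversal D_or (@wedgeN _ 0 v) pC) expr1 rmorphN.
Qed.

Lemma hom_density_half_wedge (u v : R) :
  hom_density C (fun x y => 2^-1 + wedge u v x y) =
  2^-1 ^+ l + \sum_(F : {set C * C} | (F \subset edge C) && (F != finset.set0))
    2^-1 ^+ (l - #|F|) * hd F (wedge u v).
Proof.
rewrite hom_density_expand card_edge_cycle// (bigD1 finset.set0) ?finset.sub0set//=.
rewrite cards0 subn0 hom_density_no_edge ?mulr1//.
by rewrite card_blocks.
Qed.

Lemma hom_density_half_wedge0 (v : R) :
  hom_density C (fun x y => 2^-1 + wedge 0 v x y) =
  2^-1 ^+ l + hom_density C (wedge 0 v).
Proof.
have card_E := card_edge_cycle l6 cC.
rewrite hom_density_half_wedge (bigD1 (edge C)) /=; last first.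
  by rewrite subxx -card_gt0 card_E; apply: leq_trans l6.
rewrite card_E subnn expr0 mul1r big1 ?addr0 => [|F /andP[/andP[FC F0] FE]].
  by case: (C).
rewrite hom_density_proper_subgraph_eq0 ?mulr0// card_gt0 F0 -card_E.
by apply: proper_card; rewrite finset.properEneq FE FC.
Qed.

(** The terms with one or three edges vanish by parity, those with two add up to a multiple of
    alpha_C(2), and those with at least five are of order u ^ 5. *)
Lemma hom_density_half_wedge_small :
  alpha C [:: 2]%N = 0 ->
  exists K : R, 0 <= K /\ forall u : R, 0 <= u <= 1 ->
    `|hom_density C (fun x y => 2^-1 + wedge u 0 x y) - 2^-1 ^+ l
      - 2^-1 ^+ (l - 4) * u ^+ 4 * (alpha C [:: 4]%N + alpha C [:: 2; 2]%N)%:~R|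
    <= K * u ^+ 5.
Proof.
move=> alpha2; exists (\sum_(F : {set C * C}) `|hd F (wedge (1 : R) 0)|); split.
  by apply: sumr_ge0 => F _.
move=> u /andP[u0 u1]; rewrite hom_density_half_wedge [2^-1 ^+ l + _]addrC addrK.
have wedge_u F : hd F (wedge u 0) = u ^+ #|F| * hd F (wedge 1 0).
  rewrite (@hom_density_eq _ _ _ _ (fun x y => u * wedge 1 0 x y)); last first.
    by move=> x y; rewrite -wedge_scale mulr1 mulr0.
  by rewrite hom_density_scale.
have -> : \sum_(F : {set C * C} | (F \subset edge C) && (F != finset.set0))
    2^-1 ^+ (l - #|F|) * hd F (wedge u 0) =
  2^-1 ^+ (l - 4) * u ^+ 4 * (alpha C [:: 4]%N + alpha C [:: 2; 2]%N)%:~R +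
  \sum_(F : {set C * C} | (F \subset edge C) && (5 <= #|F|)%N)
    2^-1 ^+ (l - #|F|) * hd F (wedge u 0).
  rewrite -sum_edges4 mulr_sumr.
  (* The vanishing alpha_C(2) term is put back so that both sides can be compared for each [F]
     separately. *)
  transitivity (2^-1 ^+ (l - 2) * u ^+ 2 * (alpha C [:: 2]%N)%:~R +
     (\sum_(F : {set C * C} | (F \subset edge C) && (#|F| == 4)%N)
       2^-1 ^+ (l - 4) * u ^+ 4 * hd F (wedge 1 0) +
     \sum_(F : {set C * C} | (F \subset edge C) && (5 <= #|F|)%N)
       2^-1 ^+ (l - #|F|) * hd F (wedge u 0))); last by rewrite alpha2 mulr0 add0r.
  rewrite -sum_edges2 mulr_sumr !big_mkcondr -!big_split /=; apply: eq_bigr => F _.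
  rewrite -card_gt0 wedge_u.
  have := @hom_density_odd_eq0 R (spanning_subgraph F) 1 0.
  rewrite /=; move: (hd F (wedge 1 0)) => x.
  case: #|F| => [|[|[|[|[|n]]]]] /= xodd;
    rewrite ?addr0 ?add0r ?mulrA//.
    by rewrite xodd// mulr0.
  by rewrite xodd// mulr0.
rewrite addrAC subrr add0r (le_trans (ler_norm_sum _ _ _))//.
rewrite mulr_suml big_mkcond; apply: ler_sum => F _.
case: ifP => [/andP[_ F5]|_]; last by rewrite mulr_ge0// exprn_ge0.
rewrite wedge_u !normrM mulrA mulrC ler_wpM2l// ger0_norm; last by rewrite exprn_ge0.
rewrite ger0_norm ?exprn_ge0// mulrC -[leRHS]mulr1 ler_pM ?exprn_ge0//.
  by rewrite ler_wiXn2l.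
by rewrite exprn_ile1//; lra.
Qed.

End Coefficients.

(** * Choice of (u, v) by the intermediate value theorem *)

Lemma hom_density_poly (R : numFieldType) (X : finType) (G : digraph)
    (A B : X -> X -> R) :
  exists p : {poly R}, forall s, p.[s] = hom_density G (fun x y => A x y + s * B x y).
Proof.
exists ((#|X|%:R ^+ #|G|)^-1 *: \sum_(phi : {ffun G -> X}) \prod_(e in edge G)
  ((A (phi e.1) (phi e.2))%:P + (B (phi e.1) (phi e.2)) *: 'X)).
move=> s; rewrite hornerZ mulrC /hom_density; congr (_ / _).
rewrite horner_sum /hom_sum; apply: eq_bigr => phi _.
rewrite horner_prod; apply: eq_bigr => e _.
by rewrite hornerD hornerC hornerZ hornerX mulrC.
Qed.

Lemma exists_half_wedge_density (R : rcfType) (C : digraph) :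
  (6 <= #|C|)%N -> ~~ odd #|C| -> oriented_cycle C ->
  alpha C [:: 2%N] = 0 ->
  alpha C [:: 4%N] + alpha C [:: 2%N; 2%N] != 0 ->
  gamma C != 0 ->
  Num.sg (alpha C [:: 4%N] + alpha C [:: 2%N; 2%N]) != Num.sg (gamma C) ->
  exists u v : R, [/\ 0 <= u, 0 <= v, 0 < u + v, u + v <= 4^-1 &
    hom_density C (fun x y => 2^-1 + wedge u v x y) = 2 ^- #|edge C|].
Proof.
move=> l6 l_even cC alpha2.
set A := alpha C _ + _ => A0 g0 sgAg.
have [K [K0 KP]] := hom_density_half_wedge_small R l6 cC alpha2.
rewrite -/A in KP.
pose a : R := A%:~R; pose c : R := 2^-1 ^+ (#|C| - 4).
have c0 : 0 < c by rewrite exprn_gt0// invr_gt0.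
have a0 : 0 < `|a| by rewrite normr_gt0 intr_eq0.
have K1 : 0 < K + 1 by lra.
(* The bound 1 / 4 will keep W within [0, 1]; the other makes the error K eps ^ 5 smaller than the
   main term. Using K + 1 avoids dividing by 0. *)
pose eps := Num.min 4^-1 (c * `|a| / (K + 1)).
have eps0 : 0 < eps by rewrite lt_min invr_gt0 ltr0n divr_gt0// mulr_gt0.
have eps4 : eps <= 4^-1 by rewrite ge_min lexx.
have epsK : K * eps < c * `|a|.
  have : eps <= c * `|a| / (K + 1) by rewrite ge_min lexx orbT.
  by rewrite ler_pdivlMr//; lra.
have : `|hom_density C (fun x y => 2^-1 + wedge eps 0 x y) - 2^-1 ^+ #|C|
   - c * eps ^+ 4 * a| < c * eps ^+ 4 * `|a|.
  apply: le_lt_trans (KP _ _) _; first by lra.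
  rewrite exprS mulrA (mulrAC c) ltr_pM2r ?exprn_gt0//.
set x0 := hom_density C _ - _ => x0P.
have [c1 c1_gt0 x1P] := hom_density_cycle_wedge l6 l_even cC eps0.
pose x1 : R := hom_density C (fun x y => 2^-1 + wedge 0 eps x y) - 2^-1 ^+ #|C|.
have x1E : x1 = (gamma C)%:~R * c1.
  by rewrite /x1 hom_density_half_wedge0// addrC addKr.
have x01 : x0 * x1 < 0.
  rewrite x1E; have cea : 0 < c * eps ^+ 4 by rewrite mulr_gt0// exprn_gt0.
  case: (ltgtP A 0) A0 sgAg => // [A_lt0|A_gt0] _.
  - have aN : a < 0 by rewrite ltrz0.
    rewrite (ltr0_norm aN) in x0P.
    have x0N : x0 < 0 by move: x0P; rewrite ltr_norml; lra.
    rewrite ltr0_sg// => gN.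
    have g_gt0 : 0 < gamma C.
      by case: (ltgtP (gamma C) 0) g0 gN => // ? _; rewrite ltr0_sg// eqxx.
    by rewrite nmulr_rlt0// mulr_gt0// ltr0z.
  - have aN : 0 < a by rewrite ltr0z.
    rewrite (gtr0_norm aN) in x0P.
    have x0N : 0 < x0 by move: x0P; rewrite ltr_norml; lra.
    rewrite gtr0_sg// => gN.
    have g_lt0 : gamma C < 0.
      by case: (ltgtP (gamma C) 0) g0 gN => // ? _; rewrite gtr0_sg// eqxx.
    by rewrite pmulr_rlt0// nmulr_rlt0// ltrz0.
(* The segment runs from (eps, 0) to (0, eps); on it u + v = eps stays positive. *)
have [p pP] := hom_density_poly C (fun x y => 2^-1 + wedge eps 0 x y) (wedge (- eps) eps).
have pE s : p.[s] = hom_density C (fun x y => 2^-1 + wedge (eps * (1 - s)) (eps * s) x y).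
  rewrite pP; apply: hom_density_eq => x y; rewrite /wedge; ring.
pose q := p - (2^-1 ^+ #|C|)%:P.
have q0 : q.[0] = x0.
  by rewrite hornerD hornerN hornerC pE subr0 mulr1 mulr0.
have q1 : q.[1] = x1.
  by rewrite hornerD hornerN hornerC pE subrr mulr1 mulr0.
have [s /andP[s0 s1] rs] : exists2 s, 0 <= s <= 1 & root q s.
  have [x0_le0|x0_gt0] := lerP x0 0.
    apply: poly_ivt => //; rewrite q0 q1 x0_le0 ltW//.
    have x0_lt0 : x0 < 0.
      rewrite lt_neqAle x0_le0 andbT; apply: contraTneq x01 => ->.
      by rewrite mul0r ltxx.
    by move: x01; rewrite nmulr_rlt0.
  have [] := @poly_ivt R (- q) 0 1 ler01.
    rewrite !hornerN q0 q1 !oppr_le0 oppr_ge0 ltW// ltW//.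
    by move: x01; rewrite pmulr_rlt0.
  by move=> s s01; rewrite rootN; exists s.
exists (eps * (1 - s)), (eps * s); split.
- by rewrite mulr_ge0// ?subr_ge0// ltW.
- by rewrite mulr_ge0// ltW.
- by rewrite -mulrDr subrK mulr1.
- by rewrite -mulrDr subrK mulr1.
- rewrite card_edge_cycle// -exprVn -pE; move/rootP: rs.
  by rewrite /q hornerD hornerN hornerC => /eqP; rewrite subr_eq0 => /eqP.
Qed.

(** * Power measure of boxes *)

Section Boxes.
Local Open Scope classical_set_scope.
Context d (T : measurableType d) (R : realType).
Variable m : {sigma_finite_measure set T -> \bar R}.

Definition box n (B : 'I_n -> set T) : set (n.-tuple T) :=
  [set t | forall i, B i (tnth t i)].

Lemma measurable_box n (B : 'I_n -> set T) :
  (forall i, measurable (B i)) -> measurable (box B).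
Proof.
move=> mB; have -> : box B = \bigcap_(i in [set: 'I_n]) ((@tnth n T)^~ i @^-1` B i).
  by apply/seteqP; split => t /= tB i; [move=> _|]; exact: tB.
apply: fin_bigcap_measurable => // i _.
by rewrite -[X in measurable X]setTI; exact: measurable_tnth.
Qed.

Lemma power_measure_box n (B : 'I_n -> set T) (c : 'I_n -> R) :
  (forall i, measurable (B i)) -> (forall i, m (B i) = (c i)%:E) ->
  power_measure m n (box B) = (\prod_i c i)%:E.
Proof.
elim: n B c => [|n IHn] B c mB cB.
  rewrite big_ord0 /= diracE mem_set//.
  by move=> [].
have -> : power_measure m n.+1 (box B) =
    (m \x power_measure m n)%E (B ord0 `*` box (fun i => B (lift ord0 i))).
  rewrite /= /cons_measure /pushforward; congr (_ _).
  apply/seteqP; split=> -[a t] /=.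
    move=> tB; split; first exact: (tB ord0).
    by move=> i; have := tB (lift ord0 i); rewrite /= tnthS.
  move=> [Ba tB] i; case: (unliftP ord0 i) => [j ->|->] //.
  by rewrite tnthS; exact: tB.
rewrite product_measure1E//; last by apply: measurable_box.
rewrite big_ord_recl EFinM; congr (_ * _)%E; first exact: cB.
by apply: IHn => i.
Qed.

End Boxes.

(** * Step kernels on blocks of equal measure *)

Section StepKernels.
Local Open Scope classical_set_scope.
Variables (R : realType) (X : finType) (b : R -> X).
Local Notation I := (`[0%R, 1%R]%classic : set R).
Local Notation mu := (@lebesgue_measure R).

Definition cell (x : X) : set R := [set r | I r /\ b r = x].

Hypothesis measurable_cell : forall x, measurable (cell x).
Hypothesis mu_cell : forall x, mu (cell x) = (#|X|%:R^-1)%:E.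

(** The integrand is a combination of indicators of boxes, one for each map [phi] to the blocks;
    non-negativity allows integrating it term by term. *)
Lemma density_step (C : digraph) (M : X -> X -> R) : (forall x y, 0 <= M x y) ->
  density C (fun r s => M (b r) (b s)) = hom_density C M.
Proof.
move=> M0; rewrite /density /Rintegral.
set D := [set t | _].
pose A (phi : {ffun C -> X}) := box (fun i : 'I_#|C| => cell (phi (enum_val i))).
pose k (phi : {ffun C -> X}) := \prod_(e in edge C) M (phi e.1) (phi e.2).
have k0 phi : 0 <= k phi by apply: prodr_ge0.
have mD : measurable D by apply: (measurable_box (B := fun=> I)).
have mA phi : measurable (A phi) by apply: measurable_box.
transitivity (fine (\int[power_measure mu #|C|]_(t in D)
    (\sum_(phi : {ffun C -> X}) (k phi * \1_(A phi) t)%:E))%E).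
  congr fine; apply: eq_integral => t; rewrite inE => Dt; rewrite sumEFin; congr (_%:E).
  (* A point lies only in the box of the map that records the blocks of its coordinates. *)
  pose phi0 := [ffun v => b (tnth t (enum_rank v))].
  rewrite [RHS](bigD1 phi0)//= [X in _ + X]big1 ?addr0 => [|phi phiN].
    rewrite indicE mem_set ?mulr1 => [|i].
      by apply: eq_bigr => e _; rewrite !ffunE.
    by split; [exact: Dt|rewrite ffunE enum_valK].
  rewrite indicE memNset ?mulr0// => At; move/eqP: phiN; apply.
  apply/ffunP => v; rewrite ffunE.
  by have [_] := At (enum_rank v); rewrite enum_rankK.
rewrite ge0_integral_sum//; first last.
- by move=> phi t _; rewrite lee_fin mulr_ge0// indicE.
- move=> phi; apply/measurable_EFinP; apply: measurable_funM => //.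
  apply: measurable_indic; exact: mA.
have intE phi : (\int[power_measure mu #|C|]_(t in D) (k phi * \1_(A phi) t)%:E
    = (k phi * #|X|%:R^-1 ^+ #|C|)%:E)%E.
  have -> := integralZl_indic (m := power_measure mu #|C|) mD (fun=> A phi) (k phi) _ (mA phi);
    last by move=> k_lt0; have := k0 phi; rewrite leNgt k_lt0.
  rewrite integral_indic; [|exact: mD|exact: mA].
  rewrite setIidl; last by move=> t At i; have [] := At i.
  rewrite EFinM; congr (_ * _)%E.
  apply: etrans (power_measure_box _ (fun i => mu_cell _)) _ => [i|].
    exact: measurable_cell.
  by rewrite prodr_const card_ord.
under eq_bigr do rewrite intE.
by rewrite sumEFin /= -mulr_suml exprVn.
Qed.

(** A failure at one pair of blocks would fill a product of two cells, which has positive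
    measure. *)
Lemma positive_cells_ae (P : X -> X -> Prop) :
  {ae (mu \x mu)%E, forall z : R * R, (I `*` I) z -> P (b z.1) (b z.2)} ->
  forall x y, (0 < #|X|)%N -> P x y.
Proof.
move=> [N [mN N0 PN]] x y X0; apply: contrapT => nP.
have sub : cell x `*` cell y `<=` N.
  move=> [r s] [[Ir rx] [Is sy]]; apply: PN => /= /(_ (conj Ir Is)).
  by rewrite /= rx sy.
have : ((mu \x mu)%E (cell x `*` cell y) <= 0)%E.
  rewrite -N0; apply: le_measure => //; rewrite inE//.
  by apply: measurableX; exact: measurable_cell.
have -> : (mu \x mu)%E (cell x `*` cell y) = (#|X|%:R^-1 * #|X|%:R^-1)%:E.
  apply: etrans (product_measure1E mu mu (measurable_cell x) (measurable_cell y)) _.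
  by rewrite EFinM; congr (_ * _)%E; exact: mu_cell.
rewrite lee_fin leNgt mulr_gt0//;
  by rewrite invr_gt0 ltr0n.
Qed.

Lemma measurable_step_kernel (M : X -> X -> R) :
  measurable_fun (I `*` I) (fun z : R * R => M (b z.1) (b z.2)).
Proof.
apply: (@eq_measurable_fun _ _ _ _ _ (fun z : R * R =>
  \sum_x \sum_y M x y * (\1_(cell x `*` cell y) z))).
  move=> [r s]; rewrite inE => -[Ir Is] /=.
  rewrite (bigD1 (b r))//= (bigD1 (b s))//= indicE mem_set// mulr1.
  rewrite big1 ?addr0 => [|y yN].
    rewrite big1 ?addr0// => x xN; rewrite big1// => y _.
    rewrite indicE memNset ?mulr0// => -[[_ /= rx] _].
    by rewrite rx eqxx in xN.
  rewrite indicE memNset ?mulr0// => -[_ [_ /= rx]].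
  by rewrite rx eqxx in yN.
apply: measurable_sum => x; apply: measurable_sum => y.
apply: measurable_funM => //; apply: measurable_indic.
by apply: measurableX; exact: measurable_cell.
Qed.

End StepKernels.

(** * Four quarters of the unit interval and the conclusion *)

Section Quarters.
Local Open Scope classical_set_scope.
Variable R : realType.
Local Notation I := (`[0%R, 1%R]%classic : set R).
Local Notation mu := (@lebesgue_measure R).

(** The labels follow a Gray code along [0, 1], so each bit is decided by one interval: the upper
    half, and the middle half. *)
Definition quarter (r : R) : bool * bool :=
  (2^-1 <= r, (4^-1 <= r) && (r < 3 / 4)).

Lemma cell_quarter x : exists i : interval R,
  cell quarter x = [set` i] /\ mu [set` i] = (4%:R^-1)%:E.
Proof.
case: x => -[] [].
- exists (`[2^-1, 3 / 4[)%R; split; last first.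
    by rewrite lebesgue_measure_itv /= lte_fin ifT; [rewrite -EFinB; congr (_%:E); field|lra].
  apply/seteqP; split=> r; rewrite /cell /quarter /= !in_itv /=.
    by move=> [_ [-> /andP[_ ->]]].
  by move=> /andP[r1 r2]; split; [lra|congr pair; lra].
- exists (`[3 / 4, 1])%R; split; last first.
    by rewrite lebesgue_measure_itv /= lte_fin ifT; [rewrite -EFinB; congr (_%:E); field|lra].
  apply/seteqP; split=> r; rewrite /cell /quarter /= !in_itv /=.
    by move=> [/andP[_ ->] [r1 r2]]; lra.
  by move=> /andP[r1 r2]; split; [lra|congr pair; lra].
- exists (`[4^-1, 2^-1[)%R; split; last first.
    by rewrite lebesgue_measure_itv /= lte_fin ifT; [rewrite -EFinB; congr (_%:E); field|lra].
  apply/seteqP; split=> r; rewrite /cell /quarter /= !in_itv /=.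
    by move=> [/andP[_ ?] [r1 r2]]; lra.
  by move=> /andP[r1 r2]; split; [lra|congr pair; lra].
- exists (`[0, 4^-1[)%R; split; last first.
    by rewrite lebesgue_measure_itv /= lte_fin ifT; [rewrite -EFinB; congr (_%:E); field|lra].
  apply/seteqP; split=> r; rewrite /cell /quarter /= !in_itv /=.
    by move=> [/andP[? ?] [r1 r2]]; lra.
  by move=> /andP[r1 r2]; split; [lra|congr pair; lra].
Qed.

Lemma measurable_quarter x : measurable (cell quarter x).
Proof. by have [i [-> _]] := cell_quarter x; exact: measurable_itv. Qed.

Lemma mu_quarter x : mu (cell quarter x) = (#|{: bool * bool}|%:R^-1)%:E.
Proof. by have [i [-> ->]] := cell_quarter x; rewrite card_blocks. Qed.

End Quarters.

(** As |a| = 1 and |c| <= u + v, the kernel is at most 2 (u + v) in absolute value. *)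
Lemma normr_wedge_le (R : realFieldType) (u v : R) x y :
  0 <= u -> 0 <= v -> u + v <= 4^-1 -> `|wedge u v x y| <= 2^-1.
Proof.
move=> u0 v0 uv; rewrite ler_norml /wedge /sign1 /sign2.
by case: x => -[] []; case: y => -[] []; rewrite /= ?expr0 ?expr1; lra.
Qed.

Theorem theorem18 (R : realType) (C : digraph) :
  oriented_cycle C ->
  (6 <= #|C|)%N ->
  ~~ odd #|C| ->
  alpha C [:: 2%N] = 0 ->
  alpha C [:: 4%N] + alpha C [:: 2%N; 2%N] != 0 ->
  gamma C != 0 ->
  Num.sg (alpha C [:: 4%N] + alpha C [:: 2%N; 2%N]) != Num.sg (gamma C) ->
  ~ quasirandom_forcing R C.
Proof.
move=> cC l6 l_even alpha2 A0 g0 sgAg forcing.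
have [u [v [u0 v0 uv0 uv4 densC]]] :=
  exists_half_wedge_density R l6 l_even cC alpha2 A0 g0 sgAg.
pose N x y : R := 2^-1 + wedge u v x y.
have N01 x y : 0 <= N x y <= 1.
  by have := normr_wedge_le x y u0 v0 uv4; rewrite ler_norml /N; lra.
pose W (r s : R) := N (quarter r) (quarter s).
have tW : tournamenton W.
  split.
  - split; first exact: measurable_step_kernel (@measurable_quarter R) N.
    exists 1 => r s _ _; have /andP[W0 W1] := N01 (quarter r) (quarter s).
    by rewrite ger0_norm.
  - by move=> r s _ _; have /andP[] := N01 (quarter r) (quarter s).
  - by move=> r s _ _; rewrite /W /N (wedgeN u v (quarter r)); lra.
have densW : density C W = 2 ^- #|edge C|.
  rewrite (density_step (@measurable_quarter R) (@mu_quarter R))// => x y.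
  by have /andP[] := N01 x y.
(* On this pair of blocks the kernel U equals 2 (u + v) > 0. *)
have := positive_cells_ae (@measurable_quarter R) (@mu_quarter R)
  (P := fun x y => N x y = 2^-1) (forcing W tW densW) (false, false) (true, false).
rewrite card_blocks => /(_ isT); rewrite /N /wedge /sign1 /sign2 /= expr0 expr1.
lra.
Qed.
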